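(* Let $p$ be a prime and let $k$ be a field of characteristic $p$. Let $\Delta$ be a connected simplicial pseudomanifold of dimension $d-1$ that is oriented over $k$, with vertex set $\{1,\dots,n\}$. Let $\overline{H}(\Delta)$ be the Gorenstein quotient of the generic artinian reduction of the Stanley–Reisner ring of $\Delta$ over $K=k(a_{i,j})_{1\le i\le d,\,1\le j\le n}$, and let $\ell=x_1+\dots+x_n\in\overline{H}^1(\Delta)$. Then for any nonzero $g\in\overline{H}^m(\Delta)$ with $m\le d/p$, the element $\ell^{d-pm}\cdot g^p\in\overline{H}^d(\Delta)$ is nonzero.
   Context: A simplicial pseudomanifold of dimension $d-1$ is a pure simplicial complex $\Delta$ of dimension $d-1$ such that every $(d-2)$-dimensional face lies in exactly two facets, and each connected component of the geometric realization of $\Delta$ remains connected after removing its $(d-3)$-skeleton. ''Oriented over $k$'' means that an orientation over $k$ is fixed: each facet $F=\{j_1<\dots<j_d\}$ is given an ordering of its vertices up to even permutation, recorded by the sign $\epsilon_F\in\{1,-1\}$ of the permutation taking $(j_1,\dots,j_d)$ to this ordering, such that $\sum_F \epsilon_F\,[j_1,\dots,j_d]$ is a simplicial cycle with coefficients in $k$. $K=k(a_{i,j})_{1\le i\le d,\,1\le j\le n}$ is the field of rational functions in the variables $a_{i,j}$; $K[\Delta]$ is the Stanley–Reisner ring of $\Delta$ over $K$ (the quotient of $K[x_1,\dots,x_n]$ by the squarefree monomials of non-faces); $\mu_i=\sum_j a_{i,j}x_j$ for $1\le i\le d$; $H(\Delta)=K[\Delta]/(\mu_1,\dots,\mu_d)$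 is the generic artinian reduction, a graded ring. $H^d(\Delta)$ is $1$-dimensional over $K$ and is spanned by the monomial $x^F=\prod_{j\in F}x_j$ of any facet $F$. The degree map $\deg\colon H^d(\Delta)\to K$ is the $K$-linear isomorphism determined by $\deg(x^F)=\epsilon_F/[F]$ for every facet $F=\{j_1<\dots<j_d\}$, where $[F]$ is the determinant of the $d\times d$ matrix with $(i,m)$ entry $a_{i,j_m}$. The Gorenstein quotient $\overline{H}(\Delta)$ is the graded quotient ring of $H(\Delta)$ by the kernel of the pairing $H^{\bullet}(\Delta)\times H^{d-\bullet}(\Delta)\to K$, $(g,h)\mapsto\deg(g\cdot h)$. *)

(* Defs.v *)
From HB Require Import structures.
From mathcomp Require Import all_boot all_order all_algebra.
From mathcomp Require Import boolp classical_sets functions reals topology.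
From mathcomp Require Import normedtype.
(* mpoly is imported without its notations, which clash with those of
   MathComp-Analysis. *)
From mathcomp Require Import -(notations) mpoly.

Set Implicit Arguments.
Unset Strict Implicit.
Unset Printing Implicit Defensive.

Import Order.TTheory GRing.Theory Num.Theory.
Import numFieldNormedType.Exports.

Local Open Scope ring_scope.
Local Open Scope quotient_scope.

(* MathComp's {ideal_quot I} requires a proof that I is proper; quot_ring A,
   the quotient of R by the ideal generated by A, may be the zero ring. *)
Section QuotientRing.
Variables (R : comPzRingType) (A : set R).

Definition ideal_span (x : R) : Prop :=
  exists s : seq (R * R),
    (forall c, c \in s -> A c.2) /\ x = \sum_(c <- s) c.1 * c.2.

Definition ideal_pred : R -> bool := fun x => `[< ideal_span x >].

Lemma ideal_predP x : reflect (ideal_span x) (x \in ideal_pred).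
Proof. exact: asboolP. Qed.

Lemma ideal_pred_gen x : A x -> x \in ideal_pred.
Proof.
move=> Ax; apply/ideal_predP; exists [:: (1, x)]; split.
  by move=> c; rewrite inE => /eqP ->.
by rewrite big_seq1 mul1r.
Qed.

Lemma ideal_predM a x : x \in ideal_pred -> a * x \in ideal_pred.
Proof.
move=> /ideal_predP[s [sA ->]]; apply/ideal_predP.
exists [seq (a * c.1, c.2) | c <- s]; split=> [c /mapP[c' /sA ? ->] //|].
by rewrite big_map mulr_sumr; apply: eq_bigr => c _; rewrite mulrA.
Qed.

Lemma ideal_pred_zmod_closed : zmod_closed ideal_pred.
Proof.
split=> [|x y /ideal_predP[s [sA ->]] yI].
  by apply/ideal_predP; exists [::]; rewrite big_nil.
have /ideal_predP[t [tA Ey]] := ideal_predM (-1) yI.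
apply/ideal_predP; exists (s ++ t); split=> [c|].
  by rewrite mem_cat => /orP[/sA|/tA].
by rewrite big_cat /= -Ey mulN1r.
Qed.

HB.instance Definition _ :=
  GRing.isZmodClosed.Build R ideal_pred ideal_pred_zmod_closed.

Definition ideal : zmodClosed R := GRing.ZmodClosed.clone R ideal_pred _.

Definition quot_ring : Type := {ideal_quot ideal}.

HB.instance Definition _ := GRing.Zmodule.on quot_ring.

Definition quot_pi (x : R) : quot_ring := \pi_({ideal_quot ideal}) x.

Lemma quot_pi_eq x y : quot_pi x = quot_pi y <-> ideal_span (x - y).
Proof.
rewrite /quot_pi; split=> [/eqP|xy]; last apply/eqP.
  by rewrite -Quotient.idealrBE => /ideal_predP.
by rewrite -Quotient.idealrBE; apply/ideal_predP.
Qed.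

Lemma quot_pi_surj u : exists x, u = quot_pi x.
Proof. by exists (repr (u : {ideal_quot ideal})); rewrite /quot_pi reprK. Qed.

Lemma quot_pi_is_zmod_morphism : zmod_morphism quot_pi.
Proof. exact: (raddfB (\pi_({ideal_quot ideal}))). Qed.

HB.instance Definition _ :=
  GRing.isZmodMorphism.Build R quot_ring quot_pi quot_pi_is_zmod_morphism.

Definition quot_one : quot_ring := quot_pi 1.
Definition quot_mul (u v : quot_ring) : quot_ring :=
  quot_pi (repr (u : {ideal_quot ideal}) *
           repr (v : {ideal_quot ideal})).

Lemma quot_pi_mul x y : quot_mul (quot_pi x) (quot_pi y) = quot_pi (x * y).
Proof.
have piI z : repr (\pi_({ideal_quot ideal}) z) - z \in ideal_pred.
  by rewrite Quotient.idealrBE reprK.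
apply/quot_pi_eq/ideal_predP; rewrite /quot_pi.
set x' := repr _; set y' := repr _.
have -> : x' * y' - x * y = x' * (y' - y) + y * (x' - x).
  by rewrite !mulrBr [y * x']mulrC [y * x]mulrC addrA subrK.
by rewrite rpredD ?ideal_predM ?piI.
Qed.

Lemma quot_mulA : associative quot_mul.
Proof.
move=> u v w; have [[x ->] [y ->]] := (quot_pi_surj u, quot_pi_surj v).
by have [z ->] := quot_pi_surj w; rewrite !quot_pi_mul mulrA.
Qed.

Lemma quot_mulC : commutative quot_mul.
Proof. by move=> u v; rewrite /quot_mul mulrC. Qed.

Lemma quot_mul1 : left_id quot_one quot_mul.
Proof. by move=> u; have [x ->] := quot_pi_surj u; rewrite quot_pi_mul mul1r. Qed.

Lemma quot_mulDl : left_distributive quot_mul +%R.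
Proof.
move=> u v w; have [[x ->] [y ->]] := (quot_pi_surj u, quot_pi_surj v).
have [z ->] := quot_pi_surj w.
by rewrite -raddfD !quot_pi_mul mulrDl raddfD.
Qed.

HB.instance Definition _ := GRing.Zmodule_isComPzRing.Build quot_ring
  quot_mulA quot_mulC quot_mul1 quot_mulDl.

Lemma quot_pi_is_monoid_morphism : monoid_morphism quot_pi.
Proof. by split=> // x y; rewrite -quot_pi_mul. Qed.

HB.instance Definition _ :=
  GRing.isMonoidMorphism.Build R quot_ring quot_pi quot_pi_is_monoid_morphism.
End QuotientRing.

Arguments quot_pi {R} A x.

Section Pseudomanifolds.
Variables (n : nat).
Implicit Types (Delta : {set {set 'I_n}}) (F G : {set 'I_n}).

(* A face is a set of vertices; its dimension is one less than its size. *)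
Definition simplicial_complex Delta : Prop :=
  finset.set0 \in Delta /\ forall F G, F \in Delta -> G \subset F -> G \in Delta.

Definition facets Delta : {set {set 'I_n}} :=
  [set F | maxset [pred G | G \in Delta] F].

Definition pure d Delta : Prop := forall F, F \in facets Delta -> #|F| = d.

(* The subcomplex of the faces of dimension at most d - 3. *)
Definition codim2_skeleton d Delta : {set {set 'I_n}} :=
  [set F in Delta | (#|F|.+2 <= d)%N].

Local Open Scope classical_set_scope.

(* Barycentric coordinates: the points t of the standard simplex whose support
   {i | t_i != 0} is a face. *)
Definition realization (R : realType) Delta : set 'rV[R]_n :=
  [set t | (forall i, 0 <= t 0 i) /\ \sum_i t 0 i = 1 /\
           ([set i | t 0 i != 0]%SET \in Delta)].

Arguments realization R Delta _ : clear implicits.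

Definition pseudomanifold (R : realType) d Delta : Prop :=
  [/\ simplicial_complex Delta, pure d Delta,
      forall G, G \in Delta -> #|G|.+1 = d ->
        #|[set F in facets Delta | G \subset F]%SET| = 2%N &
      forall t, realization R Delta t ->
        connected (connected_component (realization R Delta) t `\`
                   realization R (codim2_skeleton d Delta))].
End Pseudomanifolds.

Arguments realization {n} R Delta _.
Arguments pseudomanifold {n} R d Delta.

Section Orientations.
Variables (n : nat) (k : fieldType).
Implicit Types (Delta : {set {set 'I_n}}) (F G : {set 'I_n}).

(* A chain c stands for the sum of the c F *: [j_1, ..., j_r] over all
   F = {j_1 < ... < j_r}; the vertex v = j_s of F occurs in its boundary with
   sign (-1)^(s-1). *)
Definition boundary (c : {set 'I_n} -> k) G : k :=
  \sum_(F : {set 'I_n}) \sum_(v in F | F :\ v == G)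
    (-1) ^+ #|[set u in F | (u < v)%N]| * c F.

(* The orientation sign epsilon_F is encoded as (-1) ^+ eps F; the values of
   eps outside the facets are irrelevant. *)
Definition orientation Delta (eps : {set 'I_n} -> bool) : Prop :=
  forall G,
    boundary (fun F => if F \in facets Delta then (-1) ^+ eps F else 0) G = 0.
End Orientations.

Section ArtinianReduction.
Variables (k : fieldType) (d n : nat).

(* K = k(a_ij): the d * n variables are indexed by mxvec_index. *)
Definition ratfun : fieldType := {fraction mpoly (d * n) k}.

Definition coef_a (i : 'I_d) (j : 'I_n) : ratfun :=
  FracField.tofrac (mpolyX k (mnm1 (mxvec_index i j))).

Notation K := ratfun.
Notation P := (mpoly n K).
Variable Delta : {set {set 'I_n}}.

Definition xvar (j : 'I_n) : P := mpolyX K (mnm1 j).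
Definition xface (F : {set 'I_n}) : P := \prod_(j in F) xvar j.
Definition mu (i : 'I_d) : P := \sum_(j < n) coef_a i j *: xvar j.

Local Open Scope classical_set_scope.

Definition nonface_monomials : set P :=
  [set q | exists2 F, F \notin Delta & q = xface F].

Definition face_ring : comPzRingType := quot_ring nonface_monomials.

Definition parameters : set face_ring :=
  [set quot_pi nonface_monomials (mu i) | i in [set: 'I_d]].

Definition artinian_reduction : comPzRingType := quot_ring parameters.

Notation H := artinian_reduction.

Definition to_H (q : P) : H := quot_pi parameters (quot_pi nonface_monomials q).

Definition H_part (m : nat) : set H :=
  [set to_H q | q in [set q : P | q \is ishomog1 m mdeg]].

(* [F] for F = {j_1 < ... < j_d}: row i lists the a_ij for j in F, and enum F
   is increasing. *)
Definition bracket (F : {set 'I_n}) : K :=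
  \det (\matrix_(i < d, m < d) [seq coef_a i j | j <- enum F]`_m).

(* deg represents a map H^d -> K: its values outside H^d are irrelevant. *)
Definition degree_map (eps : {set 'I_n} -> bool) (deg : H -> K) : Prop :=
  [/\ forall c u v, H_part d u -> H_part d v ->
        deg (to_H (mpolyC n c) * u + v) = c * deg u + deg v,
      set_bij (H_part d) [set: K] deg &
      forall F, F \in facets Delta ->
        deg (to_H (xface F)) = (-1) ^+ eps F / bracket F].

(* The homogeneous elements of the kernel of the pairing; H^(d - m) = 0 when
   d < m. *)
Definition pairing_kernel (deg : H -> K) : set H :=
  [set u | exists2 m, H_part m u &
     (m <= d)%N -> forall v, H_part (d - m) v -> deg (u * v) = 0].

Definition gorenstein_quotient (deg : H -> K) : comPzRingType :=
  quot_ring (pairing_kernel deg).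

Definition gorenstein_part (deg : H -> K) (m : nat) :
    set (gorenstein_quotient deg) :=
  quot_pi (pairing_kernel deg) @` H_part m.

Definition ell (deg : H -> K) : gorenstein_quotient deg :=
  quot_pi (pairing_kernel deg) (to_H (\sum_(j < n) xvar j)).
End ArtinianReduction.

Arguments H_part {k d n} Delta m _.
Arguments parameters {k} d {n} Delta _.
Arguments gorenstein_part {k d n Delta} deg m.
Arguments ell {k d n Delta} deg.

(* Main.v *)
From HB Require Import structures.
Require Import Defs.
From mathcomp Require Import all_boot all_order all_algebra.
From mathcomp Require Import boolp classical_sets functions reals topology.
From mathcomp Require Import normedtype.
From mathcomp Require Import ring zify.
From mathcomp Require Import -(notations) ssrcomplements mpoly.

Set Implicit Arguments.
Unset Strict Implicit.
Unset Printing Implicit Defensive.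

Import Order.TTheory GRing.Theory Num.Theory.
Import numFieldNormedType.Exports.
Local Open Scope ring_scope.

(** Let [V m] be the degree of the monomial [x^m], for [m] of degree [d], and let
    [del r i] be the derivative by [a_(r,i)]. The theorem comes from an identity
    for derivatives of [V] in characteristic [p].

    In any characteristic, [del r i (V (x_j h)) = del r j (V (x_i h))] for every
    monomial [h] of degree [d - 1] ([vol_sym]). Hence a composite of derivatives
    of [V J] depends only on the rows of the derivatives and on the product [M]
    of [J] with the variables [x_i] of the derivatives ([polar], [polar_dop]).
    Take [p - 1] derivatives for each of the [d] rows, so that [M] has degree
    [d * p]. In characteristic [p] the result is [((p-1)!)^d * V(T)^p] if
    [M = T^p], and zero if [M] is not a [p]-th power ([polar_full_div],
    [polar_full_nondiv]).

    The derivatives treat [p]-th powers as constants. So, for [g] of degree [e],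
    [r < p] and [ell] the sum of the variables, well-chosen derivatives of the
    degree of [ell^r g^p x^E] give a nonzero multiple of [V(g x^T)^p]. Hence if
    [g x^T] has nonzero degree for some [T], then [ell^r g^p x^E] has nonzero
    degree for some [E], as long as [p e + r <= d] ([extend_vol_power]). For [g]
    of degree [m], apply this to [ell^q g]: if [ell^q g] is nonzero in the
    Gorenstein quotient and [p q + r <= d - p m], then so is
    [ell^(p q + r) g^p], and a fortiori so is [ell^(p q + r) g]. By induction on
    the exponent, [ell^s g] is nonzero for all [s <= d - p m]
    ([variable_sum_power_neq0]). One more application, with [q] and [r] the
    quotient and the remainder of [d - p m] by [p], gives the theorem.

    All the identities for [V] are proved by one uniqueness principle
    ([functional_eq0]): a functional on monomials is determined by the linear
    relations and by its values on nonfaces and on squarefree monomials of faces.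
    On facets [V] is, up to sign, the inverse of a minor, and there the identities are
    computations with determinants. *)

(** * Monomials *)

Declare Scope monomial_scope.
Delimit Scope monomial_scope with MM.
Local Notation "0" := (@mnm0 _) : monomial_scope.
Local Notation "''U_' i" := (mnm1 i) (at level 8, i at level 2).
Local Notation "m1 + m2" := (mnm_add m1 m2) : monomial_scope.
Local Notation "m1 - m2" := (mnm_sub m1 m2) : monomial_scope.
Local Notation "m *+ k" := (mnm_muln m k) : monomial_scope.
Local Notation "''X_[' m ]" := (mpolyX _ m%MM) (format "''X_[' m ]").

Section Monomials.
Variable n : nat.
Implicit Types (m : multinom n) (F : {set 'I_n}).

Definition msupport m : {set 'I_n} := [set i | m i != 0%N].

Lemma msupportD m1 m2 : msupport (m1 + m2)%MM = msupport m1 :|: msupport m2.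
Proof. by apply/setP=> i; rewrite !inE mnmDE addn_eq0 negb_and. Qed.

Lemma msupportU i : msupport 'U_i = [set i].
Proof. by apply/setP=> j; rewrite !inE mnm1E eqb0 negbK eq_sym. Qed.

Lemma mesym1E F i : mesym1 F i = (i \in F) :> nat.
Proof. by rewrite mnmE. Qed.

Lemma msupport_mesym1 F : msupport (mesym1 F) = F.
Proof. by apply/setP=> i; rewrite inE mesym1E eqb0 negbK. Qed.

Lemma mnmU_subK m i : m i != 0%N -> ('U_i + (m - 'U_i))%MM = m.
Proof.
move=> mi; apply/mnmP=> j; rewrite mnmDE mnmBE mnm1E.
by case: eqP => [<-|_]; lia.
Qed.

Lemma mdeg_gt0 m : (0 < mdeg m)%N -> exists i m', m = ('U_i + m')%MM.
Proof.
rewrite lt0n mdeg_eq0 => m0.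
have [i mi] : exists i, m i != 0%N.
  apply/existsP; apply: contraNT m0; rewrite negb_exists => /forallP h.
  by apply/eqP/mnmP=> i; rewrite mnm0E; apply/eqP; rewrite -[_ == _]negbK h.
by exists i, (m - 'U_i)%MM; rewrite mnmU_subK.
Qed.

Lemma addmCA : left_commutative (@mnm_add n).
Proof. by move=> m1 m2 m3; rewrite !addmA [(m1 + m2)%MM]addmC. Qed.

Lemma mdegUD m i : mdeg ('U_i + m)%MM = (mdeg m).+1.
Proof. by rewrite mdegD mdeg1. Qed.

Lemma mnm_split m e : (e <= mdeg m)%N ->
  exists m1 m2, m = (m1 + m2)%MM /\ mdeg m1 = e.
Proof.
elim: e m => [|e IH] m le_em.
  by exists 0%MM, m; rewrite add0m mdeg0.
have [i [m' def_m]] := mdeg_gt0 (leq_ltn_trans (leq0n e) le_em).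
rewrite def_m mdegUD ltnS in le_em.
have [m1 [m2 [def_m' <-]]] := IH _ le_em.
by exists ('U_i + m1)%MM, m2; rewrite def_m def_m' addmA mdegUD.
Qed.

Lemma squarefree_or_repeated m :
  m = mesym1 (msupport m) \/
  exists j m', m = ('U_j + m')%MM /\ msupport m' = msupport m.
Proof.
have [/existsP[j mj]|/existsPn h] := boolP [exists j, 1 < m j]%N; [right|left].
  exists j, (m - 'U_j)%MM; rewrite mnmU_subK; last by rewrite -lt0n ltnW.
  split=> //; apply/setP=> i; rewrite !inE mnmBE mnm1E.
  case: (j =P i) => [<-|_]; last by rewrite subn0.
  by rewrite /= -!lt0n subn_gt0 mj (ltnW mj).
apply/mnmP=> i; rewrite mesym1E inE.
by have := h i; case: (m i) => [|[]].
Qed.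
End Monomials.

(** * Functionals on monomials that satisfy linear relations *)

Definition minor (K : fieldType) d n (al : 'I_d -> 'I_n -> K)
    (phi : 'I_d -> 'I_n) : K :=
  \det (\matrix_(r, c) al r (phi c)).

(** The facets are listed by injections [phi] rather than in increasing order:
    minors for different orders differ by a sign only. *)
Definition generic (K : fieldType) d n (Delta : {set {set 'I_n}})
    (al : 'I_d -> 'I_n -> K) : Prop :=
  forall F, F \in facets Delta ->
    exists phi : 'I_d -> 'I_n,
      [/\ injective phi, F = [set phi c | c : 'I_d] & minor al phi != 0].

Section Spanning.
Variables (K : fieldType) (d n : nat) (Delta : {set {set 'I_n}}).
Variable al : 'I_d -> 'I_n -> K.
Hypothesis pureD : pure d Delta.
Hypothesis genericD : generic Delta al.

Lemma face_sub_facet G : G \in Delta -> exists2 F, F \in facets Delta & G \subset F.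
Proof.
move=> GD; have [F maxF GF] := @maxset_exists _ [pred G | G \in Delta] _ GD.
by exists F; rewrite ?inE.
Qed.

Lemma face_facet F : F \in Delta -> #|F| = d -> F \in facets Delta.
Proof.
move=> /face_sub_facet[F' F'f sFF'] cF; suff -> : F = F' by [].
by apply/eqP; rewrite eqEcard sFF' (pureD F'f) cF /=.
Qed.

(** Cramer's rule: the columns of [al] indexed by a facet are independent. So the
    relations express everything by the values outside the facet. *)
Lemma facet_independent F (v : 'I_n -> K) :
  F \in facets Delta -> (forall r, \sum_l al r l * v l = 0) ->
  (forall l, l \notin F -> v l = 0) -> forall l, v l = 0.
Proof.
move=> Ff rel vF; have [phi [phi_inj defF min0]] := genericD Ff.
pose M : 'M[K]_d := \matrix_(r, c) al r (phi c).
have Mu : M \in unitmx by rewrite unitmxE unitfE.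
have Mv0 : M *m \col_c v (phi c) = 0.
  apply/colP=> r; rewrite !mxE; under eq_bigr do rewrite !mxE.
  rewrite -[RHS](rel r) [RHS](bigID (mem F)) /= [X in _ + X]big1 ?addr0.
    rewrite {1}defF big_imset /=; last by move=> x y _ _ /phi_inj.
    by apply: eq_bigl => c; rewrite inE.
  by move=> l lF; rewrite vF ?mulr0.
have v0 : \col_c v (phi c) = 0 by rewrite -[LHS](mulKmx Mu) Mv0 mulmx0.
move=> l; have [|/vF //] := boolP (l \in F).
by rewrite {1}defF => /imsetP[c _ ->]; have /colP/(_ c) := v0; rewrite !mxE.
Qed.

(** A variable that occurs twice in [m] can be traded, by the linear relations,
    for variables outside a facet that contains the support of [m]; this
    enlarges the support. So the degree [e] part is spanned by faces. *)
Lemma functional_eq0 (Th : multinom n -> K) e :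
  (forall m, mdeg m = e -> msupport m \notin Delta -> Th m = 0) ->
  (forall r h, (mdeg h).+1 = e -> \sum_l al r l * Th ('U_l + h)%MM = 0) ->
  (forall F, F \in Delta -> #|F| = e -> Th (mesym1 F) = 0) ->
  forall m, mdeg m = e -> Th m = 0.
Proof.
move=> nonface rel face m.
have [k] := ubnP (n - #|msupport m|); elim: k m => // k IH m lek degm.
have [mD|/nonface -> //] := boolP (msupport m \in Delta).
have [defm|[j [h [defm sh]]]] := squarefree_or_repeated m.
  by rewrite defm face // -degm -mdeg_mesym1 -defm.
have [F Ff sF] := face_sub_facet mD.
have degh : (mdeg h).+1 = e by rewrite -degm defm mdegUD.
rewrite defm; apply: (@facet_independent F (fun l => Th ('U_l + h)%MM)) => // [r|l lF].
  exact: rel.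
apply: IH; last by rewrite mdegUD.
have lm : l \notin msupport m by apply: contra lF => /(fintype.subsetP sF).
rewrite msupportD msupportU sh cardsU1 lm.
have := max_card (mem (l |: msupport m)); rewrite cardsU1 lm card_ord; lia.
Qed.
End Spanning.

(** * Linear extension of functions on monomials *)

Section LinearExtension.
Variables (K : fieldType) (n : nat) (f : multinom n -> K).
Implicit Types q : mpoly n K.

Definition extend q := \sum_(m <- msupp q) mcoeff m q * f m.

Let extend_bounded k q : (mmeasure mdeg q <= k)%N ->
  extend q = \sum_(m : bmultinom n k) mcoeff m q * f m.
Proof.
move=> le_qk; rewrite /extend (big_mksub (bmultinom n k)) //=; first last.
- by move=> x /msize_mdeg_lt /leq_trans /(_ le_qk) ->.
- exact: msupp_uniq.
rewrite big_rmcond //= => m /memN_msupp_eq0 ->; exact: mul0r.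
Qed.

Fact extend_is_linear : scalar extend.
Proof.
move=> c q1 q2 /=.
pose k := maxn (mmeasure mdeg (c *: q1 + q2))
  (maxn (mmeasure mdeg q1) (mmeasure mdeg q2)).
rewrite !(@extend_bounded k) ?leq_max ?leqnn ?orbT //.
rewrite mulr_sumr -big_split /=; apply: eq_bigr => m _.
by rewrite linearP /= mulrDl mulrA.
Qed.

HB.instance Definition _ :=
  GRing.isLinear.Build K (mpoly n K) K ( *%R ) extend extend_is_linear.

Lemma extendX m : extend 'X_[m] = f m.
Proof. by rewrite /extend msuppX big_seq1 mcoeffX eqxx mul1r. Qed.

End LinearExtension.

Lemma extend_shift (K : fieldType) n (f : multinom n -> K) m0 q :
  extend f ('X_[m0] * q) = extend (fun m => f (m0 + m)%MM) q.
Proof.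
rewrite {1}[q]mpolyE mulr_sumr linear_sum; apply: eq_bigr => m _.
by rewrite -scalerAr linearZ /= -mpolyXD extendX.
Qed.

Lemma extend_mul_neq0 (K : fieldType) n (f : multinom n -> K) q y e :
  y \is ishomog1 e mdeg -> extend f (y * q) != 0 ->
  exists2 T, mdeg T = e & extend f ('X_[T] * q) != 0.
Proof.
move=> /dhomogP yh nz.
have [/hasP[T Ty nzT]|/hasPn eq0] :=
  boolP (has (fun T => extend f ('X_[T] * q) != 0) (msupp y)).
  by exists T => //; apply: yh.
case/eqP: nz; rewrite {1}[y]mpolyE mulr_suml linear_sum big_seq big1 //= => T Ty.
have := eq0 _ Ty; rewrite negbK => /eqP qT0.
by rewrite -scalerAl linearZ /= qT0 mulr0.
Qed.


(** * Derivations *)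

Definition derivation (K : fieldType) (D : K -> K) : Prop :=
  (forall x y, D (x + y) = D x + D y) /\ (forall x y, D (x * y) = D x * y + x * D y).

Section Derivations.
Variables (K : fieldType) (D : K -> K).
Hypothesis derD : derivation D.

Lemma der_add x y : D (x + y) = D x + D y.
Proof. by case: derD. Qed.

Lemma der_mul x y : D (x * y) = D x * y + x * D y.
Proof. by case: derD. Qed.

Lemma der0 : D 0 = 0.
Proof. by apply: (addIr (D 0)); rewrite -der_add !add0r. Qed.

Lemma der1 : D 1 = 0.
Proof.
by apply: (addIr (D 1)); rewrite -[in RHS](mulr1 1) der_mul mulr1 mul1r add0r.
Qed.

Lemma der_opp x : D (- x) = - D x.
Proof. by apply: (addIr (D x)); rewrite -der_add !addNr der0. Qed.

Lemma der_sum (I : Type) (s : seq I) (P : pred I) F :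
  D (\sum_(i <- s | P i) F i) = \sum_(i <- s | P i) D (F i).
Proof. exact: (big_morph D der_add der0). Qed.

Lemma der_mulrn x k : D (x *+ k) = D x *+ k.
Proof. by elim: k => [|k IH]; rewrite ?mulr0n ?der0 // !mulrS der_add IH. Qed.

Lemma der_mulK x y : D x = 0 -> D (x * y) = x * D y.
Proof. by move=> Dx; rewrite der_mul Dx mul0r add0r. Qed.

Lemma der_sign k : D ((-1) ^+ k) = 0.
Proof.
by rewrite -signr_odd; case: odd; rewrite ?expr1 ?der_opp ?expr0 der1 ?oppr0.
Qed.

Lemma der_exp x k : D (x ^+ k.+1) = x ^+ k * D x *+ k.+1.
Proof.
elim: k => [|k IH]; first by rewrite expr1 expr0 mul1r.
by rewrite exprS der_mul IH [in RHS]mulrS exprS; ring.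
Qed.

Lemma der_pchar p x : p \in [pchar K] -> D (x ^+ p) = 0.
Proof.
move=> charp; case: p charp => [/andP[]//|p] charp.
by rewrite der_exp -mulr_natr (pcharf0 charp) mulr0.
Qed.

Lemma der_inv x : x != 0 -> D x^-1 = - (D x / x ^+ 2).
Proof.
move=> x0; apply: (mulfI x0); apply: (addrI (D x * x^-1)).
by rewrite -der_mul divff // der1; field.
Qed.

Lemma der_det0 n (M : 'M_n) : (forall i j, D (M i j) = 0) -> D (\det M) = 0.
Proof.
elim: n M => [|n IH] M DM; first by rewrite det_mx00 der1.
rewrite (expand_det_row _ ord0) der_sum big1 // => j _.
rewrite der_mulK // /cofactor der_mulK ?der_sign // IH ?mulr0 // => i' j'.
by rewrite !mxE.
Qed.

(** The determinant is linear in row [r], with cofactors that do not involve this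
    row. *)
Lemma der_det_row n (M : 'M_n) r : (forall i j, i != r -> D (M i j) = 0) ->
  D (\det M) = \det (\matrix_(i, j) if i == r then D (M i j) else M i j).
Proof.
move=> DM; rewrite (expand_det_row M r) (expand_det_row _ r) der_sum.
apply: eq_bigr => j _; rewrite mxE eqxx der_mul [X in _ + X](_ : _ = 0).
  rewrite addr0 /cofactor; congr (_ * (_ * \det _)).
  by apply/matrixP=> i' j'; rewrite !mxE eq_sym (negPf (neq_lift _ _)).
case: n M r DM j => [|n] M r DM j; first by case: (r).
rewrite /cofactor der_mulK ?der_sign // der_det0 ?mulr0 // => i' j'.
by rewrite !mxE DM // eq_sym neq_lift.
Qed.

(** Taylor's formula for the [k]-th power of a function linear along [D]. *)
Lemma iter_der_exp x w k : D (D x) = 0 -> D w = 0 ->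
  iter k D (x ^+ k * w) = D x ^+ k * w *+ k`!.
Proof.
move=> DDx; elim: k w => [|k IH] w Dw; first by rewrite !expr0.
rewrite iterSr der_mul Dw mulr0 addr0 der_exp mulrnAl -mulrA -mulrnAr IH.
  by rewrite mulrnAr -mulrnA -factS exprSr mulrA.
by rewrite der_mulrn der_mul DDx Dw mulr0 mul0r addr0 mul0rn.
Qed.
End Derivations.

(** * Fields with derivations dual to the entries of a matrix *)

Section DualDerivations.
Variables (K : fieldType) (d n : nat) (a : 'I_d -> 'I_n -> K).
Variable del : 'I_d -> 'I_n -> K -> K.

Record dual_derivations : Prop := DualDerivations {
  dual_der : forall r i, derivation (del r i);
  dual_entry : forall r i s j, del r i (a s j) = ((r == s) && (i == j))%:R;
  dual_comm : forall r i s j x, del r i (del s j x) = del s j (del r i x) }.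

Hypothesis dualP : dual_derivations.

Notation derP := (dual_der dualP _ _).

Definition constant w := forall r i, del r i w = 0.

Lemma constant_pchar p x : p \in [pchar K] -> constant (x ^+ p).
Proof. by move=> charp r i; apply: (der_pchar derP x charp). Qed.

Definition dop (L : seq ('I_d * 'I_n)) x := foldr (fun c => del c.1 c.2) x L.

Lemma dop_sum L (I : Type) (s : seq I) (P : pred I) F :
  dop L (\sum_(i <- s | P i) F i) = \sum_(i <- s | P i) dop L (F i).
Proof. by elim: L => //= c L ->; rewrite (der_sum derP). Qed.

Lemma dop0 L : dop L 0 = 0.
Proof. by elim: L => //= c L ->; rewrite (der0 derP). Qed.

Lemma dop_mulK L w x : constant w -> dop L (w * x) = w * dop L x.
Proof. by move=> cw; elim: L => //= c L ->; rewrite (der_mulK derP). Qed.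

(** ** Derivatives of the minors *)

Lemma del_entry_neq r i s j : r != s -> del r i (a s j) = 0.
Proof. by move=> rs; rewrite (dual_entry dualP) (negPf rs). Qed.

Lemma del_bool r i (b : bool) : del r i b%:R = 0.
Proof. by case: b; rewrite ?(der1 derP) ?(der0 derP). Qed.

Lemma del_minor_linear r i j phi : del r j (del r i (minor a phi)) = 0.
Proof.
rewrite (der_det_row derP (r := r)); last first.
  by move=> s c sr; rewrite mxE del_entry_neq // eq_sym.
apply: (der_det0 derP) => s c; rewrite !mxE.
case: eqP => [->|/eqP sr]; first by rewrite (dual_entry dualP) del_bool.
by rewrite del_entry_neq // eq_sym.
Qed.

(** If [u] is linear in row [r], then [u ^+ k] has degree [k] in this row, so
    [k + 1] derivatives by entries of the row kill it. *)
Lemma dop_row_vanish r L u w :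
  (forall i j, del r j (del r i u) = 0) -> (forall i, del r i w = 0) ->
  all (fun c => c.1 == r) L -> dop L (u ^+ (size L).-1 * w) = 0 \/ L = [::].
Proof.
move=> ddu; elim/last_ind: L w => [|L c IH] w dw; first by right.
rewrite all_rcons size_rcons /= => /andP[/eqP cr Lr]; left.
rewrite /dop foldr_rcons cr -/(dop _ _) (der_mul derP) dw mulr0 addr0.
case: L => [|c' L] /= in IH Lr *; first by rewrite expr0 (der1 derP) mul0r.
rewrite (der_exp derP) mulrnAl -mulrA -mulrnAr.
suff dw' i : del r i (del r c.2 u * w *+ (size L).+1) = 0 by case: (IH _ dw' Lr).
by rewrite (der_mulrn derP) (der_mul derP) ddu dw mulr0 mul0r addr0 mul0rn.
Qed.

Let unit_rows (S : {set 'I_d}) (phi : 'I_d -> 'I_n) : 'M[K]_d :=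
  \matrix_(r, c) if r \in S then (r == c)%:R else a r (phi c).

Let del_unit_rows S phi r : injective phi ->
  del r (phi r) (\det (unit_rows S phi)) =
  if r \in S then 0 else \det (unit_rows (r |: S) phi).
Proof.
move=> phi_inj; rewrite (der_det_row derP (r := r)); last first.
  move=> s c sr; rewrite mxE; case: ifP => _; first exact: del_bool.
  by rewrite del_entry_neq // eq_sym.
case: ifPn => rS.
  rewrite (expand_det_row _ r) big1 // => c _.
  by rewrite !mxE eqxx rS del_bool mul0r.
congr (\det _); apply/matrixP=> s c; rewrite !mxE in_setU1.
case: eqP => [->|//]; rewrite (negPf rS) (dual_entry dualP) eqxx.
by rewrite (inj_eq phi_inj).
Qed.

Definition diagonal_ops k (phi : 'I_d -> 'I_n) (s : seq 'I_d) :=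
  flatten [seq nseq k (r, phi r) | r <- s].

(** Differentiating [k] times by the diagonal entry of row [r] replaces, in
    [minor a phi ^+ k], row [r] by a unit row and creates a factor [k`!]. At the
    end the matrix is the identity. *)
Lemma dop_minor_exp phi w k : injective phi -> constant w ->
  dop (diagonal_ops k phi (enum 'I_d)) (minor a phi ^+ k * w) =
  w * (k`! ^ d)%:R.
Proof.
move=> phi_inj cw.
have gen s : uniq s -> dop (diagonal_ops k phi s) (minor a phi ^+ k * w) =
    \det (unit_rows [set r in s] phi) ^+ k * w * (k`! ^ size s)%:R.
  elim: s => [_|r s IH /= /andP[rs us]].
    rewrite expn0 mulr1 /=; congr (\det _ ^+ _ * _).
    by apply/matrixP=> r c; rewrite !mxE inE.
  rewrite /diagonal_ops /= /dop foldr_cat -/(dop (diagonal_ops k phi s) _) IH //.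
  have -> x : foldr (fun c => del c.1 c.2) x (nseq k (r, phi r)) =
      iter k (del r (phi r)) x by elim: k {IH} => //= k ->.
  rewrite -mulrA (iter_der_exp derP).
  - rewrite del_unit_rows // inE (negPf rs) set_cons expnS mulnC natrM.
    by rewrite -[_ *+ _]mulr_natr -!mulrA.
  - by rewrite del_unit_rows // inE (negPf rs) del_unit_rows // setU11.
  - by rewrite mulr_natr (der_mulrn derP) cw mul0rn.
rewrite gen ?enum_uniq // size_enum_ord.
suff -> : unit_rows [set r in enum 'I_d] phi = 1%:M by rewrite det1 expr1n mul1r.
by apply/matrixP=> r c; rewrite !mxE inE mem_enum.
Qed.

(** Some mixed derivative of the minor is 1. *)
Lemma minor_neq0 phi : injective phi -> minor a phi != 0.
Proof.
move=> phi_inj; apply/eqP=> u0.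
have c1 : constant 1 by move=> r i; rewrite (der1 derP).
have := dop_minor_exp 1 phi_inj c1.
rewrite u0 mulr1 expr1 dop0 mul1r (_ : 1`! = 1)%N // exp1n.
by move/eqP; rewrite eq_sym oner_eq0.
Qed.

(** ** Euler operators *)

(** The infinitesimal row operation that adds a multiple of row [s] to row [r]. *)
Definition row_euler s r x := \sum_l a s l * del r l x.

(** The infinitesimal scaling of column [i]. *)
Definition col_euler i x := \sum_r a r i * del r i x.

Lemma derivation_comb (I : finType) (c : I -> K) (D : I -> K -> K) :
  (forall i, derivation (D i)) -> derivation (fun x => \sum_i c i * D i x).
Proof.
move=> derD; split=> x y.
  by rewrite -big_split; apply: eq_bigr => i _; rewrite (der_add (derD i)) mulrDr.
rewrite mulr_suml mulr_sumr -big_split; apply: eq_bigr => i _ /=.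
by rewrite (der_mul (derD i)); ring.
Qed.

Lemma row_euler_der s r : derivation (row_euler s r).
Proof. by apply: derivation_comb => l; apply: derP. Qed.

Lemma col_euler_der i : derivation (col_euler i).
Proof. by apply: derivation_comb => l; apply: derP. Qed.

Lemma row_euler_entry s r t j : row_euler s r (a t j) = (r == t)%:R * a s j.
Proof.
rewrite /row_euler (bigD1 j) //= big1 => [|l lj].
  by rewrite (dual_entry dualP) eqxx andbT addr0 mulrC.
by rewrite (dual_entry dualP) (negPf lj) andbF mulr0.
Qed.

Lemma col_euler_entry i t j : col_euler i (a t j) = (i == j)%:R * a t i.
Proof.
rewrite /col_euler (bigD1 t) //= big1 => [|r rt].
  by rewrite (dual_entry dualP) eqxx addr0 mulrC.
by rewrite (dual_entry dualP) (negPf rt) mulr0.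
Qed.

(** This operator replaces row [r] of the minor by row [s]. *)
Lemma row_euler_minor s r phi :
  row_euler s r (minor a phi) = (s == r)%:R * minor a phi.
Proof.
rewrite /minor (der_det_row (row_euler_der s r) (r := r)); last first.
  by move=> t c tr; rewrite mxE row_euler_entry eq_sym (negPf tr) mul0r.
case: (eqVneq s r) => [->|sr].
  rewrite mul1r; congr (\det _); apply/matrixP=> t c; rewrite !mxE.
  by case: eqP => // ->; rewrite row_euler_entry eqxx mul1r.
rewrite mul0r; apply: (determinant_alternate sr) => c.
by rewrite !mxE eqxx (negPf sr) row_euler_entry eqxx mul1r.
Qed.

Lemma col_euler_minor i phi : injective phi ->
  col_euler i (minor a phi) = (i \in [set phi c | c : 'I_d])%:R * minor a phi.
Proof.
move=> phi_inj; case: imsetP => [[c _ ->]|iphi].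
  rewrite mul1r /minor -det_tr (der_det_row (col_euler_der (phi c)) (r := c)).
    congr (\det _); apply/matrixP=> t s; rewrite !mxE.
    by case: eqP => // ->; rewrite col_euler_entry eqxx mul1r.
  move=> t s tc; rewrite !mxE col_euler_entry (inj_eq phi_inj).
  by rewrite eq_sym (negPf tc) mul0r.
rewrite mul0r; apply: (der_det0 (col_euler_der i)) => t c.
rewrite !mxE col_euler_entry; case: eqP => [ic|]; last by rewrite mul0r.
by case: iphi; exists c.
Qed.

Lemma del_comm_col_euler r j i x :
  col_euler i (del r j x) = del r j (col_euler i x) - (i == j)%:R * del r j x.
Proof.
rewrite /col_euler (der_sum derP).
under [in RHS]eq_bigr => s _ do
  rewrite (der_mul derP) (dual_entry dualP) (dual_comm dualP r j).
have entry_part : \sum_s ((r == s) && (j == i))%:R * del s i x =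
    (j == i)%:R * del r i x.
  rewrite (bigD1 r) //= eqxx /= big1 ?addr0 // => s sr.
  by rewrite eq_sym (negPf sr) mul0r.
rewrite big_split /= entry_part [i == j]eq_sym addrAC.
by case: eqP => [->|_]; rewrite ?mul0r ?mul0r ?subrr add0r.
Qed.
End DualDerivations.

(** * Derivatives of the degree map *)

(** The properties of [m |-> deg (x^m)] that determine it. *)
Record volume_functional (K : fieldType) d n (Delta : {set {set 'I_n}})
    (a : 'I_d -> 'I_n -> K) (V : multinom n -> K) : Prop := VolumeFunctional {
  vol_nonface : forall m, mdeg m = d -> msupport m \notin Delta -> V m = 0;
  vol_rel : forall r h, (mdeg h).+1 = d -> \sum_l a r l * V ('U_l + h)%MM = 0;
  vol_facet : forall F, F \in facets Delta -> exists (phi : 'I_d -> 'I_n) (b : bool),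
    [/\ injective phi, F = [set phi c | c : 'I_d] &
        V (mesym1 F) = (-1) ^+ b * (minor a phi)^-1] }.

Section VolumeDerivatives.
Variables (K : fieldType) (d n : nat) (Delta : {set {set 'I_n}}).
Variables (a : 'I_d -> 'I_n -> K) (del : 'I_d -> 'I_n -> K -> K).
Variable V : multinom n -> K.
Hypotheses (complexD : simplicial_complex Delta) (pureD : pure d Delta).
Hypotheses (dualP : dual_derivations a del) (volP : volume_functional Delta a V).

Notation derP := (dual_der dualP _ _).

Lemma generic_entries : generic Delta a.
Proof.
move=> F /(vol_facet volP)[phi [b [phi_inj defF _]]].
by exists phi; split=> //; apply: minor_neq0 dualP _ phi_inj.
Qed.

Lemma der_facet (D : K -> K) F (phi : 'I_d -> 'I_n) (b : bool) e : derivation D ->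
  injective phi -> V (mesym1 F) = (-1) ^+ b * (minor a phi)^-1 ->
  D (minor a phi) = e * minor a phi -> D (V (mesym1 F)) = - e * V (mesym1 F).
Proof.
move=> derD phi_inj -> De; have u0 := minor_neq0 dualP phi_inj.
by rewrite (der_mulK derD) ?der_sign // (der_inv derD) // De; field.
Qed.

(** Both sides satisfy the linear relations, since the operator turns a relation
    for row [r] into one for row [s]. On facets this is [row_euler_minor]. *)
Lemma row_euler_vol s r m : mdeg m = d ->
  row_euler a del s r (V m) = - (s == r)%:R * V m.
Proof.
have derE := row_euler_der dualP s r.
suff: forall m, mdeg m = d -> row_euler a del s r (V m) + (s == r)%:R * V m = 0.
  by move=> eq0 /eq0/eqP; rewrite addr_eq0 mulNr => /eqP.
apply: (functional_eq0 generic_entries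
  (Th := fun m => row_euler a del s r (V m) + (s == r)%:R * V m))
  => [m' degm nonf|t h degh|F FD cF].
- by rewrite (vol_nonface volP) // (der0 derE) mulr0 addr0.
- have := congr1 (row_euler a del s r) (vol_rel volP t degh).
  rewrite (der0 derE) (der_sum derE).
  under eq_bigr => l _ do rewrite (der_mul derE) (row_euler_entry dualP) -mulrA.
  rewrite big_split /= -mulr_sumr (vol_rel volP s degh) mulr0 add0r => rel0.
  under eq_bigr => l _ do rewrite mulrDr mulrCA.
  by rewrite big_split /= -mulr_sumr (vol_rel volP t degh) mulr0 addr0.
- have Ff := face_facet pureD FD cF.
  have [phi [b [phi_inj defF VF]]] := vol_facet volP Ff.
  by rewrite (der_facet derE phi_inj VF (row_euler_minor dualP s r phi)) mulNr addNr.
Qed.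

(** Scaling column [i] by [c] rescales [x_i] by the inverse of [c]. *)
Lemma col_euler_vol i m : mdeg m = d ->
  col_euler a del i (V m) = - (m i)%:R * V m.
Proof.
have derE := col_euler_der dualP i.
suff: forall m, mdeg m = d -> col_euler a del i (V m) + (m i)%:R * V m = 0.
  by move=> eq0 /eq0/eqP; rewrite addr_eq0 mulNr => /eqP.
apply: (functional_eq0 generic_entries
  (Th := fun m => col_euler a del i (V m) + (m i)%:R * V m))
  => [m' degm nonf|t h degh|F FD cF].
- by rewrite (vol_nonface volP) // (der0 derE) mulr0 addr0.
- have := congr1 (col_euler a del i) (vol_rel volP t degh).
  rewrite (der0 derE) (der_sum derE).
  under eq_bigr => l _ do rewrite (der_mul derE) (col_euler_entry dualP).
  rewrite big_split /= => rel0.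
  under eq_bigr => l _ do rewrite mnmDE mnm1E natrD mulrDl !mulrDr.
  rewrite !big_split /= addrA.
  under [X in _ + X]eq_bigr => l _ do rewrite mulrCA.
  rewrite -mulr_sumr (vol_rel volP t degh) mulr0 addr0 -[RHS]rel0 addrC.
  congr (_ + _); apply: eq_bigr => l _; rewrite eq_sym.
  by case: eqP => [->|_]; rewrite ?mul1r // !mul0r mulr0.
- have Ff := face_facet pureD FD cF.
  have [phi [b [phi_inj defF VF]]] := vol_facet volP Ff.
  rewrite (der_facet derE phi_inj VF (col_euler_minor dualP i phi_inj)) -defF.
  by rewrite mesym1E mulNr addNr.
Qed.

(** The difference [W i j h] of the two sides satisfies the linear relations in
    [h], so [h] may be taken to be a face [G] with [d - 1] vertices. By
    [row_euler_vol] it also satisfies them in [j], and by antisymmetry in [i].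
    Hence [i] and [j] may be moved outside a facet that contains [G], where both
    terms are zero or equal. *)
Lemma vol_sym r i j h : (mdeg h).+1 = d ->
  del r i (V ('U_j + h)%MM) = del r j (V ('U_i + h)%MM).
Proof.
pose W i j h := del r i (V ('U_j + h)%MM) - del r j (V ('U_i + h)%MM).
have WC i' j' h' : W i' j' h' = - W j' i' h' by rewrite /W opprB.
(* The relations in the second index, by [row_euler_vol]. *)
have Wrel s j' h' : (mdeg h').+1 = d -> \sum_l a s l * W j' l h' = 0.
  move=> degh; rewrite /W; under eq_bigr => l _ do rewrite mulrBr.
  rewrite sumrB -/(row_euler a del s r (V ('U_j' + h')%MM)) row_euler_vol ?mdegUD //.
  have := congr1 (del r j') (vol_rel volP s degh).
  rewrite (der0 derP) (der_sum derP).
  under eq_bigr => l _ do rewrite (der_mul derP) (dual_entry dualP).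
  rewrite big_split /= (bigD1 j') //= eqxx andbT big1 ?addr0 => [|l lj].
    rewrite [s == r]eq_sym => /eqP; rewrite addrC addr_eq0 => /eqP ->.
    by rewrite mulNr opprK addNr.
  by rewrite [j' == l]eq_sym (negPf lj) andbF mul0r.
(* The relations in the monomial. *)
have Whrel s i' j' h' : (mdeg h').+2 = d -> \sum_l a s l * W i' j' ('U_l + h')%MM = 0.
  have half i1 j1 : (mdeg h').+2 = d ->
      \sum_l a s l * del r i1 (V ('U_j1 + ('U_l + h'))%MM) =
      - ((r == s)%:R * V ('U_j1 + ('U_i1 + h'))%MM).
    move=> degh; have degUh : (mdeg ('U_j1 + h')%MM).+1 = d by rewrite mdegUD.
    have := congr1 (del r i1) (vol_rel volP s degUh).
    rewrite (der0 derP) (der_sum derP).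
    under eq_bigr => l _ do rewrite (der_mul derP) (dual_entry dualP) addmCA.
    rewrite big_split /= (bigD1 i1) //= eqxx andbT big1 ?addr0 => [|l li].
      by move/eqP; rewrite addrC addr_eq0 => /eqP.
    by rewrite [i1 == l]eq_sym (negPf li) andbF mul0r.
  move=> degh; rewrite /W; under eq_bigr => l _ do rewrite mulrBr.
  by rewrite sumrB !half // opprK addmCA addNr.
have Wnonface i' j' h' : (mdeg h').+1 = d -> msupport h' \notin Delta ->
    W i' j' h' = 0.
  move=> degh nonf; rewrite /W !(vol_nonface volP) ?mdegUD ?(der0 derP) ?subrr //.
    apply: contra nonf => /(proj2 complexD); apply.
    by rewrite msupportD finset.subsetUr.
  by apply: contra nonf => /(proj2 complexD); apply; rewrite msupportD finset.subsetUr.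
move=> degh; apply/eqP; rewrite -subr_eq0; apply/eqP; rewrite -/(W i j h).
apply: (functional_eq0 generic_entries (Th := W i j) (e := d.-1)) => //;
  last by rewrite -degh.
- by move=> m degm; apply: Wnonface; rewrite degm -degh.
- by move=> s h' degh'; apply: Whrel; rewrite degh' -degh.
move=> G GD cG; have [F Ff sGF] := face_sub_facet GD.
have degG : (mdeg (mesym1 G)).+1 = d by rewrite mdeg_mesym1 cG -degh.
(* Off the facet [F] each term of [W] is zero or the derivative of the inverse
   of a minor by an entry which does not occur in it. *)
have Woff i' j' : i' \notin F -> j' \notin F -> W i' j' (mesym1 G) = 0.
  move=> iF jF; have [->|ij] := eqVneq i' j'; first by rewrite /W subrr.
  suff half x y : x != y -> x \notin F -> y \notin F ->
      del r x (V ('U_y + mesym1 G)%MM) = 0.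
    by rewrite /W !half ?subrr // eq_sym.
  move=> xy xF yF; have yG : y \notin G by apply: contra yF => /(fintype.subsetP sGF).
  have -> : ('U_y + mesym1 G)%MM = mesym1 (y |: G).
    apply/mnmP=> l; rewrite mnmDE mnm1E !mesym1E in_setU1 eq_sym.
    by case: eqP => [->|//]; rewrite (negPf yG).
  have [yGD|nonf] := boolP (y |: G \in Delta); last first.
    rewrite (vol_nonface volP) ?(der0 derP) ?msupport_mesym1 //.
    by rewrite mdeg_mesym1 cardsU1 yG cG -degh.
  have yGf : y |: G \in facets Delta.
    by apply: (face_facet pureD yGD); rewrite cardsU1 yG cG -degh.
  have [phi [b [phi_inj defyG VyG]]] := vol_facet volP yGf.
  rewrite (der_facet (e := 0) derP phi_inj VyG) ?oppr0 ?mul0r //.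
  apply: (der_det0 derP) => s c; rewrite mxE (dual_entry dualP).
  case: (x =P phi c) => [xc|]; last by rewrite andbF.
  have : x \in y |: G by rewrite defyG xc imset_f.
  rewrite in_setU1 (negPf xy) /= => xG; case/negP: xF; exact: (fintype.subsetP sGF).
have Woff1 i' j' : i' \notin F -> W i' j' (mesym1 G) = 0.
  move=> iF; apply: (facet_independent generic_entries
    (v := fun l => W i' l (mesym1 G)) Ff) => [s|l lF].
    exact: Wrel.
  exact: Woff.
apply: (facet_independent generic_entries
  (v := fun l => W i l (mesym1 G)) Ff) => [s|l lF].
  exact: Wrel.
by rewrite WC Woff1 ?oppr0.
Qed.

(** ** Iterated derivatives *)

(** [polar R m] is the common value of [dop L (V J)] for all lists [L] of entries
    with rows [R] and all [J] such that [J] and the columns of [L] add up to [m].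
    The definition picks some decomposition of [m]; [polar_cons] and [polar_dop]
    show that the choice does not matter. *)
Fixpoint polar (R : seq 'I_d) (m : multinom n) : K :=
  if R is r :: R' then
    if [pick i | m i != 0%N] is Some i then del r i (polar R' (m - 'U_i)%MM) else 0
  else V m.

Let polar_cons_of_sym R :
  (forall r i j h, (mdeg h).+1 = d + size R ->
    del r i (polar R ('U_j + h)%MM) = del r j (polar R ('U_i + h)%MM))%N ->
  forall r i m, mdeg m = (d + size R)%N ->
    polar (r :: R) ('U_i + m)%MM = del r i (polar R m).
Proof.
move=> symR r i m degm /=; case: pickP => [j mj|/(_ i)]; last first.
  by rewrite mnmDE mnm1E eqxx.
have [<-|ij] := eqVneq i j; first by rewrite addmC addmK.
have mj0 : m j != 0%N by move: mj; rewrite mnmDE mnm1E (negPf ij).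
rewrite -{1}(mnmU_subK mj0) addmCA [('U_j + _)%MM]addmC addmK symR.
  by rewrite mnmU_subK.
by rewrite -(mdegUD _ j) mnmU_subK.
Qed.

(** [vol_sym] propagates, because the new derivative commutes with the old ones. *)
Lemma polar_sym R r i j h : (mdeg h).+1 = (d + size R)%N ->
  del r i (polar R ('U_j + h)%MM) = del r j (polar R ('U_i + h)%MM).
Proof.
elim: R r i j h => [|r' R IH] r i j h; first by rewrite addn0; apply: vol_sym.
rewrite addnS => -[degh].
have [l [h' defh]] : exists l h', h = ('U_l + h')%MM.
  apply: mdeg_gt0.
  by rewrite degh addn_gt0 (leq_ltn_trans (leq0n r) (ltn_ord r)).
move: degh; rewrite defh mdegUD => degh'.
rewrite ![('U_ _ + ('U_l + h'))%MM]addmCA !(polar_cons_of_sym IH) ?mdegUD //.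
by rewrite (dual_comm dualP) IH // (dual_comm dualP).
Qed.

Lemma polar_cons r R i m : mdeg m = (d + size R)%N ->
  polar (r :: R) ('U_i + m)%MM = del r i (polar R m).
Proof. by apply: polar_cons_of_sym => *; apply: polar_sym. Qed.

Lemma polar_deg_gt0 (r : 'I_d) k (m : multinom n) : mdeg m = (d + k)%N ->
  exists i m', m = ('U_i + m')%MM.
Proof.
move=> degm; apply: mdeg_gt0.
by rewrite degm addn_gt0 (leq_ltn_trans (leq0n r) (ltn_ord r)).
Qed.

Definition columns (L : seq ('I_d * 'I_n)) : multinom n :=
  \big[@mnm_add n/0%MM]_(c <- L) 'U_(c.2).

Lemma columns_cons c L : columns (c :: L) = ('U_(c.2) + columns L)%MM.
Proof. by rewrite /columns big_cons. Qed.

Lemma mdeg_columns L : mdeg (columns L) = size L.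
Proof.
by elim: L => [|c L IH]; rewrite ?columns_cons ?mdegUD ?IH // /columns big_nil mdeg0.
Qed.

Lemma polar_dop L J : mdeg J = d ->
  polar (map fst L) (columns L + J)%MM = dop del L (V J).
Proof.
move=> degJ; elim: L => [|c L IH]; first by rewrite /columns big_nil add0m.
rewrite columns_cons -addmA polar_cons ?IH //.
by rewrite mdegD mdeg_columns degJ size_map addnC.
Qed.

Lemma columns_surj R I : mdeg I = size R ->
  exists L, map fst L = R /\ columns L = I.
Proof.
elim: R I => [|r R IH] I degI.
  exists [::]; split=> //; rewrite /columns big_nil.
  by apply/esym/eqP; rewrite -mdeg_eq0 degI.
have [i [I' defI]] : exists i I', I = ('U_i + I')%MM by apply: mdeg_gt0; rewrite degI.
move: degI; rewrite defI mdegUD => -[/IH[L [<- <-]]].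
by exists ((r, i) :: L); rewrite columns_cons.
Qed.

Lemma polar_perm R R' m : perm_eq R R' -> mdeg m = (d + size R)%N ->
  polar R m = polar R' m.
Proof.
have front r R1 m1 : r \in R1 -> mdeg m1 = (d + size R1)%N ->
    polar R1 m1 = polar (r :: rem r R1) m1.
  elim: R1 m1 => // r' R1 IH m1 rR1 degm1.
  rewrite /= in rR1 degm1 *; have [->//|r'r] := eqVneq r' r.
  have {}rR1 : r \in R1 by move: rR1; rewrite inE eq_sym (negPf r'r).
  have [i [m2 defm1]] := polar_deg_gt0 r degm1.
  move: degm1; rewrite addnS defm1 mdegUD => -[degm2].
  have szR1 := size_rem rR1; have R1gt0 : (0 < size R1)%N by case: (R1) rR1.
  have [j [m3 defm2]] := polar_deg_gt0 r degm2.
  move: (degm2); rewrite defm2 mdegUD -(prednK R1gt0) addnS => -[degm3].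
  rewrite -/(polar (r' :: R1) _) -/(polar [:: r, r' & rem r R1] _).
  rewrite polar_cons -?defm2 // IH // defm2 polar_cons ?szR1 // addmCA.
  rewrite polar_cons; last by rewrite mdegUD /= szR1 degm3 addnS.
  by rewrite polar_cons ?szR1 // (dual_comm dualP).
elim: R' R m => [|r R' IH] R m; first by move/perm_nilP->.
move=> eqR degm; have rR : r \in R by rewrite (perm_mem eqR) mem_head.
have eqR' : perm_eq (rem r R) R'.
  by rewrite -(perm_cons r) (perm_trans _ eqR) // perm_sym perm_to_rem.
rewrite (front r) //; have [i [m' defm]] := polar_deg_gt0 r degm.
rewrite defm mdegUD (perm_size (perm_to_rem rR)) /= addnS in degm; case: degm => degm'.
by rewrite defm !polar_cons -?(perm_size eqR') // IH.
Qed.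

(** ** Linear relations between iterated derivatives *)

(** The derivatives by entries of other rows do not see the coefficients of the
    relation for row [r]. *)
Lemma polar_rel_notin R r h : r \notin R -> (mdeg h).+1 = (d + size R)%N ->
  \sum_l a r l * polar R ('U_l + h)%MM = 0.
Proof.
elim: R h => [|r' R IH] h; first by rewrite addn0 => _; apply: vol_rel volP r h.
rewrite inE negb_or => /andP[rr' rR]; rewrite addnS => -[degh].
have [i [h' defh]] := polar_deg_gt0 r degh.
move: (degh); rewrite defh mdegUD => degh'.
have /(congr1 (del r' i)) := IH _ rR degh'.
rewrite (der0 derP) (der_sum derP) => rel.
rewrite -[RHS]rel; apply: eq_bigr => l _; rewrite addmCA polar_cons ?mdegUD //.
by rewrite (der_mulK derP) // (dual_entry dualP) eq_sym (negPf rr').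
Qed.

(** Each of the [k] derivatives by an entry of row [r] hits the coefficients of
    the relation once, and by symmetry all these terms are equal. *)
Lemma polar_rel_nseq R r k h : r \notin R -> (mdeg h).+1 = (d + k + size R)%N ->
  \sum_l a r l * polar (nseq k r ++ R) ('U_l + h)%MM =
  - k%:R * polar (nseq k.-1 r ++ R) h.
Proof.
move=> rR; elim: k h => [|k IH] h.
  by rewrite addn0 => degh; rewrite oppr0 mul0r polar_rel_notin.
rewrite addnS addSn => -[degh].
have szR j : (d + size (nseq j r ++ R) = d + j + size R)%N.
  by rewrite size_cat size_nseq addnA.
have [i [h' defh]] : exists i h', h = ('U_i + h')%MM.
  by apply: (polar_deg_gt0 r (k := k + size R)); rewrite degh addnA.
move: (degh); rewrite defh mdegUD => degh'.
have dRHS : del r i (- k%:R * polar (nseq k.-1 r ++ R) h') =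
    - k%:R * polar (nseq k r ++ R) ('U_i + h')%MM.
  case: (k) degh' => [|k1] degh'; first by rewrite oppr0 !mul0r (der0 derP).
  rewrite polar_cons ?szR; last by move: degh'; rewrite addnS addSn => -[].
  rewrite (der_mulK derP) // (der_opp derP) (der_mulrn derP) (der1 derP).
  by rewrite mul0rn oppr0.
have /(congr1 (del r i)) := IH _ degh'.
rewrite dRHS (der_sum derP).
under eq_bigr => l _ do rewrite (der_mul derP) (dual_entry dualP) eqxx /=.
rewrite big_split /= (bigD1 i) //= eqxx mul1r big1 ?addr0 => [|l li]; last first.
  by rewrite eq_sym (negPf li) mul0r.
under [LHS in _ -> LHS = _]eq_bigr => l _ do
  rewrite addmCA -/(polar (r :: (nseq k r ++ R)) _) polar_cons ?szR ?mdegUD //.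
rewrite addrC => /(canRL (addrK _)) ->.
by rewrite -natr1; ring.
Qed.


Definition linear_form r : mpoly n K := \sum_l a r l *: 'X_['U_l].

Lemma linear_form_homog r : linear_form r \is ishomog1 1 mdeg.
Proof.
apply: rpred_sum => l _; apply: rpredZ; rewrite dhomogX; apply/eqP/mdeg1.
Qed.

Lemma extend_polar_linear_form R r k e q : r \notin R ->
  q \is ishomog1 e mdeg -> e.+1 = (d + k + size R)%N ->
  extend (polar (nseq k r ++ R)) (linear_form r * q) =
  - k%:R * extend (polar (nseq k.-1 r ++ R)) q.
Proof.
move=> rR /dhomogP qh defe; rewrite mulr_suml linear_sum /=.
under eq_bigr => l _ do rewrite -scalerAl linearZ /= extend_shift /extend mulr_sumr.
rewrite exchange_big mulr_sumr /=; apply: eq_big_seq => m mq.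
under eq_bigr => l _ do rewrite mulrCA.
rewrite -mulr_sumr polar_rel_nseq ?mulrA; last by rewrite -defe -(qh m mq).
  by rewrite [_ * - _]mulrC.
by [].
Qed.

(** Each factor [linear_form r] removes one derivative by an entry of row [r];
    when none is left, the last factor gives the relation for row [r]. *)
Lemma extend_polar_power R r k h : r \notin R -> (mdeg h).+1 = (d + size R)%N ->
  extend (polar (nseq k r ++ R)) (linear_form r ^+ k.+1 * 'X_[h]) = 0.
Proof.
move=> rR degh; elim: k => [|k IH].
  rewrite expr1 (extend_polar_linear_form (e := mdeg h)) ?oppr0 ?mul0r ?addn0 //.
  by rewrite dhomogX.
rewrite exprS -mulrA (extend_polar_linear_form (e := (k.+1 + mdeg h)%N)) //.
- by rewrite IH mulr0.
- apply: dhomogM; last by rewrite dhomogX.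
  by have := dhomogMn k.+1 (linear_form_homog r); rewrite mul1n.
by rewrite -addnS degh; lia.
Qed.

Section PositiveCharacteristic.
Variable p : nat.
Hypothesis charp : p \in [pchar K].

Let p_gt0 : (0 < p)%N. Proof. by rewrite prime_gt0 ?(pcharf_prime charp). Qed.

Let charM : p \in [pchar (mpoly n K)]. Proof. by rewrite pchar_lalg. Qed.

(** In characteristic [p] only [p]-th powers of variables occur in the [p]-th
    power of [linear_form r], so [extend_polar_power] becomes a relation whose
    coefficients are the [p]-th powers of the entries. *)
Lemma polar_rel_frobenius R r h : r \notin R -> (mdeg h).+1 = (d + size R)%N ->
  \sum_l a r l ^+ p * polar (nseq p.-1 r ++ R) ('U_l *+ p + h)%MM = 0.
Proof.
move=> rR degh; have := extend_polar_power p.-1 rR degh; rewrite prednK //.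
rewrite -(pFrobenius_autE charM) rmorph_sum mulr_suml linear_sum /= => rel.
rewrite -[RHS]rel; apply: eq_bigr => l _.
rewrite pFrobenius_autE exprZn mpolyXn -scalerAl linearZ /=.
by rewrite -mpolyXD extendX.
Qed.

(** The inverse of a minor [u] is [u ^+ p.-1] times the constant [u ^- p]. *)
Lemma vol_facet_exp F : F \in facets Delta -> exists (phi : 'I_d -> 'I_n) w,
  [/\ injective phi, F = [set phi c | c : 'I_d], constant del w,
      V (mesym1 F) = minor a phi ^+ p.-1 * w & w = V (mesym1 F) ^+ p].
Proof.
move=> /(vol_facet volP)[phi [b [phi_inj defF VF]]].
exists phi, (V (mesym1 F) ^+ p); split=> //.
  exact: (constant_pchar dualP _ charp).
have u0 := minor_neq0 dualP phi_inj.
rewrite VF exprMn -[((-1) ^+ b) ^+ p](pFrobenius_autE charp) rmorph_sign.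
rewrite mulrCA; congr (_ * _).
by rewrite -{2}(prednK p_gt0) exprS mulrCA -exprMn divff // expr1n mulr1.
Qed.

(** As a functional of the [d] variables that are not used by the derivatives,
    this satisfies all linear relations: the obstruction in row [r] is
    multiplied by [p], by [polar_rel_nseq]. On a facet, [p] derivatives by
    entries of one row kill the power [p - 1] of the minor. *)
Lemma polar_nseq_eq0 r m : mdeg m = (d + p)%N -> polar (nseq p r) m = 0.
Proof.
move=> degm; have [|I [J [defm degI]]] := @mnm_split n m p; first by lia.
have {degm} degJ : mdeg J = d by move: degm; rewrite defm mdegD degI; lia.
rewrite {m}defm; move: J degJ.
have [L [LR LI]] : exists L, map fst L = nseq p r /\ columns L = I.
  by apply: columns_surj; rewrite size_nseq.
have polarE J : mdeg J = d -> polar (nseq p r) (I + J)%MM = dop del L (V J).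
  by move=> degJ; rewrite -LR -LI polar_dop.
apply: (functional_eq0 generic_entries
  (Th := fun J => polar (nseq p r) (I + J)%MM)) => /=.
- by move=> J degJ nonf; rewrite polarE // (vol_nonface volP) // (dop0 dualP).
- move=> s h degh; under eq_bigr => l _ do rewrite addmCA.
  have degIh : (mdeg (I + h)%MM).+1 = (d + p)%N by rewrite mdegD degI -degh; lia.
  have [->|sr] := eqVneq s r.
    rewrite -[nseq p r]cats0 polar_rel_nseq ?addn0 //.
    by rewrite (pcharf0 charp) oppr0 mul0r.
  by rewrite polar_rel_notin ?size_nseq // mem_nseq (negPf sr) andbF.
move=> F FD cF; rewrite polarE ?mdeg_mesym1 //.
have [phi [w [phi_inj _ cw VF _]]] := vol_facet_exp (face_facet pureD FD cF).
have sL : size L = p by rewrite -(size_map fst) LR size_nseq.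
have Lr : all (fun c => c.1 == r) L.
  by rewrite -(all_map fst (pred1 r)) LR all_nseq /= eqxx orbT.
have [] := dop_row_vanish dualP (fun i j => del_minor_linear dualP r i j phi) (cw r) Lr.
  by rewrite sL -VF.
by move=> L0; move: p_gt0; rewrite -sL L0.
Qed.

Let perm_split_row (r : 'I_d) R :
  perm_eq (nseq (count_mem r R) r ++ seq.filter (predC1 r) R) R.
Proof.
have /all_pred1P := filter_all (pred1 r) R; rewrite size_filter => <-.
exact/permPl/perm_filterC.
Qed.

Lemma polar_count_eq0 R r m : mdeg m = (d + size R)%N -> count_mem r R = p ->
  polar R m = 0.
Proof.
move=> degm cR; pose R' := seq.filter (predC1 r) R.
have eqR : perm_eq R (R' ++ nseq p r).
  by rewrite perm_sym perm_catC -cR perm_split_row.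
rewrite (polar_perm eqR degm); rewrite (perm_size eqR) in degm.
elim: R' m degm {eqR} => [|r' R' IH] m degm.
  by rewrite polar_nseq_eq0 // degm size_nseq.
have [i [m' defm]] := polar_deg_gt0 r degm.
move: degm; rewrite defm mdegUD /= addnS => -[degm].
by rewrite -/(polar (r' :: (R' ++ nseq p r)) _) polar_cons // IH // (der0 derP).
Qed.

Lemma col_euler_polar R i m : mdeg m = (d + size R)%N ->
  col_euler a del i (polar R m) = - (m i)%:R * polar R m.
Proof.
elim: R m => [|r R IH] m degm; first by rewrite col_euler_vol // degm addn0.
have [j [m' defm]] := polar_deg_gt0 r degm.
move: degm; rewrite defm mdegUD addnS => -[degm'].
rewrite polar_cons // (del_comm_col_euler dualP) IH // mnmDE mnm1E natrD.
rewrite (der_mulK derP); first by rewrite eq_sym; ring.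
by rewrite (der_opp derP) (der_mulrn derP) (der1 derP) mul0rn oppr0.
Qed.

Definition full_rows : seq 'I_d := flatten [seq nseq p.-1 r | r <- enum 'I_d].

Lemma count_full_rows r : count_mem r full_rows = p.-1.
Proof.
rewrite /full_rows count_flatten -map_comp sumnE big_map big_enum /=.
rewrite (bigD1 r) //= big1 ?addn0 => [|s sr]; first by rewrite count_nseq /= eqxx mul1n.
by rewrite count_nseq /= (negPf sr).
Qed.

Lemma size_full_rows : size full_rows = (d * p.-1)%N.
Proof.
rewrite size_flatten /shape -map_comp sumnE big_map big_enum /=.
by under eq_bigr do rewrite size_nseq; rewrite sum_nat_const card_ord.
Qed.

(** By [polar_count_eq0] all derivatives of [polar full_rows m] vanish; so does
    its image [- (m i)%:R * polar full_rows m] under [col_euler a del i]. *)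
Lemma polar_full_nondiv m i : mdeg m = (d * p)%N -> ~~ (p %| m i)%N ->
  polar full_rows m = 0.
Proof.
move=> degm ndiv.
have degm' : mdeg m = (d + size full_rows)%N.
  by rewrite size_full_rows degm -{1}(prednK p_gt0) mulnS.
apply/eqP; have /eqP := col_euler_polar i degm'.
rewrite /col_euler big1 => [|r _].
  rewrite eq_sym mulNr oppr_eq0 mulf_eq0 -(dvdn_pcharf charp) (negPf ndiv) //.
rewrite -polar_cons // (polar_count_eq0 (r := r)) ?mulr0 //.
  by rewrite mdegUD degm' /= addnS.
by rewrite /= eqxx count_full_rows add1n prednK.
Qed.

Lemma generic_frobenius : generic Delta (fun r i => a r i ^+ p).
Proof.
move=> F Ff; have [phi [phi_inj defF u0]] := generic_entries Ff.
exists phi; split=> //; rewrite /minor.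
rewrite (_ : \matrix_(_, _) _ =
  map_mx (pFrobenius_aut charp) (\matrix_(r, c) a r (phi c))).
  by rewrite det_map_mx /= pFrobenius_autE expf_neq0.
by apply/matrixP=> r c; rewrite !mxE pFrobenius_autE.
Qed.

(** Both sides satisfy, in [T], the linear relations whose coefficients are the
    [p]-th powers of the entries, and they agree on facets by [dop_minor_exp]. *)
Lemma polar_full_div T : mdeg T = d ->
  polar full_rows (T *+ p)%MM = (p.-1`! ^ d)%:R * V T ^+ p.
Proof.
move=> degT; apply/eqP; rewrite -subr_eq0; apply/eqP; move: T degT.
have full_dop T : mdeg T = d -> (T *+ p = T *+ p.-1 + T)%MM.
  by rewrite -mulmSr prednK.
apply: (functional_eq0 generic_frobenius
  (Th := fun T => polar full_rows (T *+ p)%MM - (p.-1`! ^ d)%:R * V T ^+ p)).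
- move=> T degT nonf; rewrite full_dop // (vol_nonface volP) //.
  rewrite expr0n -leqn0 leqNgt p_gt0.
  have [|L [<- <-]] := @columns_surj full_rows (T *+ p.-1)%MM.
    by rewrite mdegMn degT size_full_rows.
  by rewrite polar_dop // (vol_nonface volP) // (dop0 dualP) mulr0 subrr.
- move=> r h degh; pose R := seq.filter (predC1 r) full_rows.
  have eqR : perm_eq full_rows (nseq p.-1 r ++ R).
    by rewrite perm_sym -(count_full_rows r) perm_split_row.
  have szR : (p.-1 + size R = d * p.-1)%N.
    by rewrite -size_full_rows (perm_size eqR) size_cat size_nseq.
  under eq_bigr => l _ do rewrite mulrBr [_ ^+ p * (_ * _)]mulrCA -exprMn.
  rewrite sumrB -mulr_sumr.
  have -> : \sum_l (a r l * V ('U_l + h)%MM) ^+ p = 0.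
    under eq_bigr => l _ do rewrite -(pFrobenius_autE charp).
    by rewrite -rmorph_sum /= (vol_rel volP) // rmorph0.
  rewrite mulr0 subr0 -[RHS](@polar_rel_frobenius R r (h *+ p)%MM).
  + apply: eq_bigr => l _; congr (_ * _).
    have -> : (('U_l + h) *+ p = 'U_l *+ p + h *+ p)%MM.
      by apply/mnmP=> i; rewrite !(mnmDE, mulmnE) mulnDl.
    apply: polar_perm => //; rewrite size_full_rows mdegD !mdegMn mdeg1.
    by rewrite -mulnDl add1n degh -mulnS prednK.
  + by rewrite mem_filter /= eqxx.
  + rewrite mdegMn; apply: (@addnI p.-1).
    by rewrite addnCA szR addnS -addSn -mulnS prednK // -mulSn degh.
move=> F FD cF; have degF : mdeg (mesym1 F) = d by rewrite mdeg_mesym1.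
have [phi [w [phi_inj defF cw VF <-]]] := vol_facet_exp (face_facet pureD FD cF).
pose L := diagonal_ops p.-1 phi (enum 'I_d).
have LR : map fst L = full_rows.
  rewrite /L /diagonal_ops /full_rows map_flatten -map_comp; congr flatten.
  by apply: eq_map => r /=; rewrite map_nseq.
have LF : columns L = (mesym1 F *+ p.-1)%MM.
  have -> : columns L = (\big[@mnm_add n/0%MM]_(r : 'I_d) ('U_(phi r) *+ p.-1))%MM.
    rewrite /columns /L /diagonal_ops big_flatten big_map big_enum /=.
    by apply: eq_bigr => r _; rewrite big_nseq /mnm_muln Monoid.iteropE.
  apply/mnmP=> i; rewrite mnm_sumE mulmnE mesym1E defF.
  under eq_bigr => r _ do rewrite mulmnE mnm1E.
  rewrite -big_distrl /=; congr (_ * _)%N; case: imsetP => [[r _ ->]|iphi].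
    rewrite (bigD1 r) //= eqxx big1 ?addn0 // => s sr.
    by rewrite (inj_eq phi_inj) (negPf sr).
  by rewrite big1 // => r _; case: eqP => // ri; case: iphi; exists r.
rewrite full_dop // -LF -LR polar_dop // VF (dop_minor_exp dualP) //.
by rewrite mulrC subrr.
Qed.

(** ** The sum of the variables *)

Definition variable_sum : mpoly n K := \sum_j 'X_['U_j].

Definition ffun_monomial r (c : {ffun 'I_r -> 'I_n}) : multinom n :=
  \big[@mnm_add n/0%MM]_k 'U_(c k).

Lemma ffun_monomialE r (c : {ffun 'I_r -> 'I_n}) i :
  ffun_monomial c i = (\sum_k (c k == i))%N.
Proof. by rewrite mnm_sumE; apply: eq_bigr => k _; rewrite mnm1E. Qed.

Lemma mdeg_ffun_monomial r (c : {ffun 'I_r -> 'I_n}) : mdeg (ffun_monomial c) = r.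
Proof.
rewrite mdeg_sum; under eq_bigr => k _ do rewrite mdeg1.
by rewrite sum_nat_const card_ord muln1.
Qed.

Lemma variable_sum_exp r : variable_sum ^+ r =
  \sum_(c : {ffun 'I_r -> 'I_n}) 'X_[ffun_monomial c].
Proof.
rewrite -[in LHS](card_ord r) -prodr_const bigA_distr_bigA /=.
by apply: eq_bigr => c _; rewrite (big_morph (mpolyX K) (mpolyXD K) (mpolyX0 n K)).
Qed.

Lemma fact_pred_neq0 : (p.-1`!)%:R != 0 :> K.
Proof.
have pr := pcharf_prime charp; rewrite -(dvdn_pcharf charp).
have: (p.-1 < p)%N by rewrite prednK.
elim: p.-1 => [|k IH] kp; first by rewrite dvdn1; case: (p) pr => [|[]].
by rewrite factS Euclid_dvdM // gtnNdvd //= IH // ltnW.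
Qed.

(** In the expansion of [x^A * ell^r], where [ell] is the sum of the variables,
    exactly one term is a [p]-th power. If [r > 0], let [x_j] divide [x^T] and
    take for [x^A] the quotient of [x^(p T)] by [x_j^r]: as [r < p], another
    term has an exponent strictly between two consecutive multiples of [p]. *)
Lemma split_power_monomial (T : multinom n) r : (r < p)%N -> (r <= p * mdeg T)%N ->
  exists (A : multinom n) (c0 : {ffun 'I_r -> 'I_n}),
  (A + ffun_monomial c0)%MM = (T *+ p)%MM /\
  forall c : {ffun 'I_r -> 'I_n}, c != c0 ->
    exists i, ~~ (p %| (A + ffun_monomial c)%MM i)%N.
Proof.
case: r => [|r] rp degT.
  exists (T *+ p)%MM, (finfun (fun k : 'I_0 => let: Ordinal _ lt_k0 := k in
    match notF lt_k0 with end)).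
  rewrite /ffun_monomial big_ord0 addm0; split=> // c /eqP; case.
  by apply/ffunP=> -[].
have [j [T' defT]] : exists j T', T = ('U_j + T')%MM.
  by apply: mdeg_gt0; case: (mdeg T) degT; rewrite ?muln0.
pose A := ('U_j *+ (p - r.+1) + T' *+ p)%MM; exists A, [ffun => j].
split=> [|c cj].
  apply/mnmP=> i; rewrite defT !(mnmDE, mulmnE) ffun_monomialE mnm1E.
  under eq_bigr => k _ do rewrite ffunE.
  by rewrite sum_nat_const card_ord; lia.
have [k ckj] : exists k, c k != j.
  apply/existsP; apply: contraNT cj => /existsPn h; apply/eqP/ffunP=> k.
  by rewrite ffunE; apply/eqP; rewrite -[_ == _]negbK.
exists (c k); rewrite !(mnmDE, mulmnE) ffun_monomialE mnm1E.
rewrite eq_sym (negPf ckj) mul0n add0n dvdn_addr ?dvdn_mull // gtnNdvd //.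
  by rewrite (bigD1 k) //= eqxx.
apply: leq_ltn_trans rp; rewrite -[X in (_ <= X)%N]card_ord -sum1_card.
by apply: leq_sum => k' _; case: eqP.
Qed.

(** [x^E] divides the monomial [x^A] of [split_power_monomial], and the
    derivatives are taken by entries whose columns give the cofactor [x^I]. Of
    the expansion of [ell^r] only the term with a [p]-th power survives them. *)
Lemma extend_vol_power g e r T : g \is ishomog1 e mdeg ->
  (r < p)%N -> (p * e + r <= d)%N -> (e + mdeg T)%N = d ->
  extend V ('X_[T] * g) != 0 ->
  exists2 E, (mdeg E + (p * e + r))%N = d &
    extend V (g ^+ p * variable_sum ^+ r * 'X_[E]) != 0.
Proof.
move=> /dhomogP gh rp le_d degT nz.
have le_r : (r <= p * mdeg T)%N.
  rewrite -(leq_add2l (p * e)) -mulnDr degT (leq_trans le_d) // leq_pmull //.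
have [A [c0 [defA nondiv]]] := split_power_monomial rp le_r.
have degA : (mdeg A + r + p * e = p * d)%N.
  have := congr1 mdeg defA; rewrite mdegD mdegMn mdeg_ffun_monomial => ->.
  by rewrite -degT; lia.
have le_E : (d - (p * e + r) <= mdeg A)%N.
  have : (d <= p * d)%N by rewrite leq_pmull.
  by lia.
have [E [I [defAE degE]]] := mnm_split le_E.
have degI : mdeg I = size full_rows.
  move: degA; rewrite size_full_rows defAE mdegD degE => degA.
  by rewrite -subn1 mulnBr muln1; nia.
exists E; first by rewrite degE subnK.
have [L [LR LI]] := columns_surj degI.
suff dopE : dop del L (extend V (g ^+ p * variable_sum ^+ r * 'X_[E])) =
    (p.-1`! ^ d)%:R * extend V ('X_[T] * g) ^+ p.
  apply: contraNneq nz => eq0; move/eqP: dopE.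
  rewrite eq0 (dop0 dualP) eq_sym mulf_eq0 expf_eq0 natrX expf_eq0.
  by rewrite (negPf fact_pred_neq0) andbF => /andP[].
have -> : g ^+ p = \sum_(m <- msupp g) mcoeff m g ^+ p *: 'X_[m *+ p].
  rewrite {1}[g]mpolyE -(pFrobenius_autE charM) rmorph_sum.
  by apply: eq_bigr => m _; rewrite /= pFrobenius_autE exprZn mpolyXn.
rewrite variable_sum_exp extend_shift {2}/extend.
rewrite -(pFrobenius_autE charp) rmorph_sum [RHS]mulr_sumr.
rewrite -mulrA mulr_suml linear_sum (dop_sum dualP).
apply: eq_big_seq => m /gh degm.
rewrite -scalerAl linearZ /= (dop_mulK dualP);
  last exact: (constant_pchar dualP _ charp).
rewrite rmorphM /= !pFrobenius_autE [RHS]mulrCA; congr (_ * _).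
rewrite mulr_suml mulr_sumr linear_sum (dop_sum dualP) (bigD1 c0) //=.
have dopX (c : {ffun 'I_r -> 'I_n}) :
    dop del L (extend V ('X_[m *+ p] * ('X_[ffun_monomial c] * 'X_[E]))) =
    polar full_rows (m *+ p + (A + ffun_monomial c))%MM.
  rewrite -!mpolyXD extendX -polar_dop ?LR ?LI.
    by congr polar; rewrite defAE; apply/mnmP=> i; rewrite !mnmDE; lia.
  by rewrite !mdegD mdegMn mdeg_ffun_monomial degE degm; lia.
rewrite dopX defA big1 ?addr0.
  have -> : (m *+ p + T *+ p = (T + m) *+ p)%MM.
    by apply/mnmP=> i; rewrite !(mnmDE, mulmnE); lia.
  by rewrite polar_full_div // mdegD degm addnC.
move=> c /nondiv[i ndiv]; rewrite dopX (polar_full_nondiv (i := i)) //.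
  by rewrite !mdegD mdegMn mdeg_ffun_monomial degm; lia.
by rewrite mnmDE dvdn_addr // mulmnE dvdn_mull.
Qed.

Lemma variable_sum_homog s : variable_sum ^+ s \is ishomog1 s mdeg.
Proof.
rewrite -[X in ishomog1 X]mul1n; apply: dhomogMn.
by apply: rpred_sum => l _; rewrite dhomogX; apply/eqP/mdeg1.
Qed.

(** For [s > 0] the exponent [s %/ p] is smaller than [s], and [extend_vol_power]
    passes from it to [s]; the extra factor [g ^+ p.-1] is harmless. *)
Lemma variable_sum_power_neq0 g m T s : g \is ishomog1 m mdeg ->
  (m + mdeg T)%N = d -> extend V ('X_[T] * g) != 0 -> (p * m + s <= d)%N ->
  exists2 T', (m + s + mdeg T')%N = d &
    extend V ('X_[T'] * (variable_sum ^+ s * g)) != 0.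
Proof.
move=> gh degT nz; have [k] := ubnP s; elim: k s => // k IH s ltsk le_d.
have [->|s_gt0] := posnP s; first by exists T; rewrite ?addn0 // mul1r.
have p_gt1 : (1 < p)%N by rewrite prime_gt1 ?(pcharf_prime charp).
have ltqs : (s %/ p < s)%N by rewrite ltn_Pdiv.
have defs := divn_eq s p; have rp := ltn_pmod s p_gt0.
have [||T1 degT1 nz1] := IH (s %/ p)%N; [lia|lia|].
have g1h : variable_sum ^+ (s %/ p) * g \is ishomog1 (m + s %/ p) mdeg.
  by rewrite addnC; apply: dhomogM => //; apply: variable_sum_homog.
have [|E degE nzE] := extend_vol_power g1h rp _ degT1 nz1; first by lia.
have yh : g ^+ p.-1 * 'X_[E] \is ishomog1 (m * p.-1 + mdeg E) mdeg.
  by apply: dhomogM; [apply: dhomogMn | rewrite dhomogX].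
have [|T' degT' nzT'] := @extend_mul_neq0 K n V (variable_sum ^+ s * g) _ _ yh.
  rewrite (_ : _ * _ = (variable_sum ^+ (s %/ p) * g) ^+ p *
    variable_sum ^+ (s %% p) * 'X_[E]) //.
  have gp : g ^+ p = g * g ^+ p.-1 by rewrite -exprS prednK.
  by rewrite exprMn gp -exprM [in LHS]defs exprD; ring.
exists T' => //; rewrite degT'.
have : (m * p = m + m * p.-1)%N by rewrite -mulnS prednK.
lia.
Qed.

Lemma variable_sum_frobenius_neq0 g m T : g \is ishomog1 m mdeg ->
  (p * m <= d)%N -> (m + mdeg T)%N = d -> extend V ('X_[T] * g) != 0 ->
  extend V (variable_sum ^+ (d - p * m) * g ^+ p) != 0.
Proof.
move=> gh le_d degT nz; set N := (d - p * m)%N.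
have defN := divn_eq N p; have rp := ltn_pmod N p_gt0.
have p_gt1 : (1 < p)%N by rewrite prime_gt1 ?(pcharf_prime charp).
have lt_q : (N %/ p <= N)%N by rewrite leq_div.
have [|T1 degT1 nz1] := variable_sum_power_neq0 (s := (N %/ p)%N) gh degT nz.
  by lia.
have g1h : variable_sum ^+ (N %/ p) * g \is ishomog1 (m + N %/ p) mdeg.
  by rewrite addnC; apply: dhomogM => //; apply: variable_sum_homog.
have [|E degE] := extend_vol_power g1h rp _ degT1 nz1; first by lia.
(* There is no room left for [E]. *)
have -> : E = 0%MM by apply/eqP; rewrite -mdeg_eq0; lia.
rewrite mpolyX0 mulr1; congr (extend V _ != 0).
by rewrite [in RHS]defN exprMn -exprM exprD; ring.
Qed.
End PositiveCharacteristic.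
End VolumeDerivatives.

(** * Partial derivatives of rational functions *)

Section QuotientRule.
Variable F : fieldType.

Definition quotient_rule (u v du dv : F) := (du * v - u * dv) / v ^+ 2.

Lemma quotient_rule_eq u v du dv u1 v1 du1 dv1 : v != 0 -> v1 != 0 ->
  u * v1 = u1 * v -> du * v1 + u * dv1 = du1 * v + u1 * dv ->
  quotient_rule u v du dv = quotient_rule u1 v1 du1 dv1.
Proof.
move=> v0 v10 eq_uv eq_d; rewrite /quotient_rule.
have -> : du = (du1 * v + u1 * dv - u * dv1) / v1 by rewrite -eq_d addrK mulfK.
have -> : u = u1 * v / v1 by rewrite -eq_uv mulfK.
by field; apply/andP.
Qed.

Lemma addf_quotient (u v u' v' : F) : v != 0 -> v' != 0 ->
  u / v + u' / v' = (u * v' + u' * v) / (v * v').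
Proof. by move=> v0 v'0; field; apply/andP. Qed.

Lemma quotient_ruleD u v du dv u' v' du' dv' : v != 0 -> v' != 0 ->
  quotient_rule (u * v' + u' * v) (v * v')
    (du * v' + u * dv' + (du' * v + u' * dv)) (dv * v' + v * dv') =
  quotient_rule u v du dv + quotient_rule u' v' du' dv'.
Proof. by move=> v0 v'0; rewrite /quotient_rule; field; apply/andP. Qed.

Lemma mulf_quotient (u v u' v' : F) :
  u / v * (u' / v') = (u * u') / (v * v').
Proof. by rewrite invfM mulrACA. Qed.

Lemma quotient_ruleM u v du dv u' v' du' dv' : v != 0 -> v' != 0 ->
  quotient_rule (u * u') (v * v') (du * u' + u * du') (dv * v' + v * dv') =
  quotient_rule u v du dv * (u' / v') + u / v * quotient_rule u' v' du' dv'.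
Proof. by move=> v0 v'0; rewrite /quotient_rule; field; apply/andP. Qed.
End QuotientRule.

Section FractionDerivation.
Variables (R : idomainType) (D : R -> R).
Hypotheses (D_add : forall x y, D (x + y) = D x + D y).
Hypotheses (D_mul : forall x y, D (x * y) = D x * y + x * D y).
Local Notation tofrac := (@FracField.tofrac R).
Local Notation "x %:F" := (tofrac x).

Lemma fractionP (x : {fraction R}) :
  x = (\n_(repr x))%:F / (\d_(repr x))%:F /\ (\d_(repr x))%:F != 0.
Proof.
have d0 : (\d_(repr x))%:F != 0 by rewrite tofrac_eq0 denom_ratioP.
split=> //; apply: (mulIf d0); rewrite divfK // -{1}[x]reprK.
move: (repr x) => r; rewrite /GRing.mul /= !piE; apply/eqmodP.
rewrite /= FracField.equivfE /FracField.mulf.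
by rewrite !numden_Ratio ?oner_eq0 ?mulr1 ?denom_ratioP // mulrC.
Qed.

Let fraction_exists (x : {fraction R}) : exists u v, x = u%:F / v%:F /\ v%:F != 0.
Proof. by have := fractionP x; do 2!eexists; eassumption. Qed.

Definition frac_der (x : {fraction R}) :=
  quotient_rule (\n_(repr x))%:F (\d_(repr x))%:F
    (D \n_(repr x))%:F (D \d_(repr x))%:F.

Let frac_derE u v : v%:F != 0 ->
  frac_der (u%:F / v%:F) = quotient_rule u%:F v%:F (D u)%:F (D v)%:F.
Proof.
move=> v0; rewrite /frac_der; have [eqx v10] := fractionP (u%:F / v%:F).
set u1 := \n_ _ in eqx v10 *; set v1 := \d_ _ in eqx v10 *.
have eq_uv : u1%:F * v%:F = u%:F * v1%:F.
  by rewrite -[u%:F](divfK v0) eqx mulrAC divfK.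
apply: quotient_rule_eq => //.
have /(congr1 D) : u1 * v = u * v1.
  by apply/eqP; rewrite -tofrac_eq !tofracM eq_uv.
by rewrite !D_mul => /(congr1 tofrac); rewrite !tofracD !tofracM.
Qed.

Lemma frac_der_derivation : derivation frac_der.
Proof.
split=> x y; have [u [v [-> v0]]] := fraction_exists x;
  have [u' [v' [-> v'0]]] := fraction_exists y.
  rewrite addf_quotient // -!tofracM -tofracD !frac_derE ?tofracM ?mulf_neq0 //.
  by rewrite D_add !D_mul !(tofracD, tofracM) quotient_ruleD.
rewrite mulf_quotient -!tofracM !frac_derE ?tofracM ?mulf_neq0 //.
by rewrite !D_mul !(tofracD, tofracM) quotient_ruleM.
Qed.

Lemma frac_der_tofrac u : frac_der u%:F = (D u)%:F.
Proof.
have D1 : D 1 = 0.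
  by apply: (addIr (D 1)); rewrite -[in RHS](mulr1 1) D_mul mulr1 mul1r add0r.
rewrite -[u%:F]divr1 -tofrac1 frac_derE ?tofrac_eq0 ?oner_eq0 //.
by rewrite /quotient_rule D1 tofrac0 tofrac1 expr1n !mulr1 mulr0 subr0 divr1.
Qed.
End FractionDerivation.

Lemma frac_der_comm (R : idomainType) (D1 D2 : R -> R) :
  (forall x y, D1 (x + y) = D1 x + D1 y) ->
  (forall x y, D1 (x * y) = D1 x * y + x * D1 y) ->
  (forall x y, D2 (x + y) = D2 x + D2 y) ->
  (forall x y, D2 (x * y) = D2 x * y + x * D2 y) ->
  (forall x, D1 (D2 x) = D2 (D1 x)) ->
  forall x, frac_der D1 (frac_der D2 x) = frac_der D2 (frac_der D1 x).
Proof.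
move=> add1 mul1 add2 mul2 comm x.
have der1 := frac_der_derivation add1 mul1.
have der2 := frac_der_derivation add2 mul2.
have [] := fractionP x; set u := FracField.tofrac _; set v := FracField.tofrac _.
move=> defx v0; have defu : x * v = u by rewrite defx divfK.
have com_tofrac z : frac_der D1 (frac_der D2 (FracField.tofrac z)) =
    frac_der D2 (frac_der D1 (FracField.tofrac z)).
  by rewrite !frac_der_tofrac // comm.
have com_v := com_tofrac _ : frac_der D1 (frac_der D2 v) = frac_der D2 (frac_der D1 v).
apply: (mulIf v0); have := com_tofrac \n_(repr x); rewrite -/u -defu.
rewrite (der_mul der2 x) (der_mul der1 x) (der_add der1) (der_add der2).
rewrite (der_mul der1 (frac_der D2 x) v) (der_mul der1 x (frac_der D2 v)).
rewrite (der_mul der2 (frac_der D1 x) v) (der_mul der2 x (frac_der D1 v)).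
rewrite com_v addrA [RHS]addrA => /addIr.
by rewrite -!addrA [frac_der D1 x * _ + _]addrC => /addIr.
Qed.

Section RationalFunctions.
Variables (k : fieldType) (d n : nat).
Local Notation K := (ratfun k d n).

Definition partial (r : 'I_d) (i : 'I_n) : K -> K :=
  frac_der (@mderiv (d * n) k (mxvec_index r i)).

Lemma partial_dual : dual_derivations (@coef_a k d n) partial.
Proof.
split=> [r i|r i s j|r i s j x].
- by apply: frac_der_derivation; [exact: mderivD | exact: mderivM].
- rewrite /partial frac_der_tofrac; last exact: mderivM.
  rewrite mderivX mnm1E (_ : (_ == _) = ((r == s) && (i == j))); last first.
    rewrite (inj_eq (@cast_ord_inj _ _ _)) (inj_eq enum_rank_inj) xpair_eqE.
    by rewrite eq_sym [j == i]eq_sym.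
  case: andP => [[/eqP-> /eqP->]|_]; last by rewrite scale0r rmorph0.
  rewrite scale1r (_ : ('U_ _ - 'U_ _)%MM = 0%MM) ?mpolyX0 ?rmorph1 //.
  by apply/mnmP=> l; rewrite mnmBE subnn mnm0E.
by apply: frac_der_comm; [exact: mderivD | exact: mderivM | exact: mderivD |
  exact: mderivM | exact: mderiv_comm].
Qed.
End RationalFunctions.

(** * The degree map of the generic artinian reduction *)

Section ArtinianReduction.
Variables (k : fieldType) (d n : nat) (Delta : {set {set 'I_n}}).
Local Notation K := (ratfun k d n).
Local Notation P := (mpoly n K).
Local Notation H := (artinian_reduction k d Delta).
Local Notation to_H := (@to_H k d n Delta).
Local Notation nonfaces := (@nonface_monomials k d n Delta).

Lemma to_HD q1 q2 : to_H (q1 + q2) = to_H q1 + to_H q2.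
Proof. by rewrite /Defs.to_H !rmorphD. Qed.

Lemma to_HM q1 q2 : to_H (q1 * q2) = to_H q1 * to_H q2.
Proof. by rewrite /Defs.to_H !rmorphM. Qed.

Lemma to_H0 : to_H 0 = 0.
Proof. by rewrite /Defs.to_H !rmorph0. Qed.

Lemma to_H1 : to_H 1 = 1.
Proof. by rewrite /Defs.to_H !rmorph1. Qed.

Lemma to_HB q1 q2 : to_H (q1 - q2) = to_H q1 - to_H q2.
Proof. by rewrite /Defs.to_H !rmorphB. Qed.

Lemma to_HX q e : to_H (q ^+ e) = to_H q ^+ e.
Proof. by elim: e => [|e IH]; rewrite ?expr0 ?to_H1 // !exprS to_HM IH. Qed.

Lemma to_H_surj u : exists q, u = to_H q.
Proof.
have [v ->] := quot_pi_surj u; have [q ->] := quot_pi_surj v.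
by exists q.
Qed.

Lemma quot_pi_gen0 (R : comPzRingType) (A : set R) x : A x -> quot_pi A x = 0.
Proof.
move=> Ax; rewrite -(rmorph0 (quot_pi A)); apply/quot_pi_eq/ideal_predP.
by rewrite subr0; apply: ideal_pred_gen.
Qed.

Lemma quot_pi_eq0 (R : comPzRingType) (A : set R) x :
  quot_pi A x = 0 -> ideal_span A x.
Proof. by move=> x0; rewrite -[x]subr0; apply/quot_pi_eq; rewrite x0 rmorph0. Qed.

Lemma xfaceE F : @xface k d n F = 'X_[mesym1 F].
Proof.
rewrite /xface /xvar -(big_morph (mpolyX K) (mpolyXD K) (mpolyX0 n K)).
congr mpolyX; apply/mnmP=> i; rewrite mnm_sumE mesym1E.
under eq_bigr => j _ do rewrite mnm1E.
have [iF|iF] := boolP (i \in F).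
  by rewrite (bigD1 i) //= eqxx big1 ?addn0 // => j /andP[_ /negPf->].
by rewrite big1 // => j jF; case: eqP => // ji; rewrite -ji jF in iF.
Qed.

Lemma to_H_nonface m : msupport m \notin Delta -> to_H 'X_[m] = 0.
Proof.
move=> nonf; have -> : m = (mesym1 (msupport m) + (m - mesym1 (msupport m)))%MM.
  apply/mnmP=> i; rewrite mnmDE mnmBE mesym1E inE.
  by case: (m i) => //= j; rewrite subn1.
rewrite mpolyXD -xfaceE to_HM [X in X * _](_ : _ = 0) ?mul0r //.
rewrite /Defs.to_H [quot_pi _ (@xface _ _ _ _)]quot_pi_gen0 ?rmorph0 //.
by exists (msupport m).
Qed.

Lemma to_H_mu r q : to_H (mu k n r * q) = 0.
Proof.
rewrite to_HM [X in X * _](_ : _ = 0) ?mul0r // /Defs.to_H.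
by apply: quot_pi_gen0; exists r.
Qed.

Variables (eps : {set 'I_n} -> bool) (deg : H -> K).
Hypotheses (complexD : simplicial_complex Delta) (pureD : pure d Delta).
Hypothesis degP : degree_map eps deg.

Definition volume (m : multinom n) : K := deg (to_H 'X_[m]).

Lemma deg_homog q : q \is ishomog1 d mdeg -> deg (to_H q) = extend volume q.
Proof.
have [deg_lin _ _] := degP.
have part q1 : q1 \is ishomog1 d mdeg -> H_part Delta d (to_H q1) by exists q1.
have deg0 : deg 0 = 0.
  have H0 : H_part Delta d (0 : H) by exists 0; rewrite ?to_H0 //; apply: rpred0.
  apply: (addIr (deg 0)); have := deg_lin 1 0 0 H0 H0.
  by rewrite mulr0 addr0 mul1r add0r => <-.
move=> /dhomogP qh; rewrite /extend {1}[q]mpolyE.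
elim: (msupp q) qh => [|m s IH] sh; first by rewrite !big_nil to_H0.
have mh : 'X_[m] \is @ishomog1 n K d mdeg by rewrite dhomogX; apply/eqP/sh/mem_head.
have sh' : {in s, forall m, mdeg m = d}.
  by move=> m' m's; apply: sh; rewrite inE m's orbT.
rewrite !big_cons to_HD -mul_mpolyC to_HM deg_lin ?IH //; first exact: part.
apply: part; rewrite big_seq; apply: rpred_sum => m' m's; apply: rpredZ.
by rewrite dhomogX; apply/eqP/sh'.
Qed.

Lemma volume_volP : volume_functional Delta (@coef_a k d n) volume.
Proof.
have [_ _ deg_facet] := degP; split.
- move=> m degm nonf; rewrite /volume to_H_nonface //.
  by rewrite -to_H0 deg_homog ?linear0 // rpred0.
- move=> r h degh; have muh : mu k n r * 'X_[h] \is ishomog1 (1 + mdeg h)%N mdeg.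
    apply: dhomogM; last by rewrite dhomogX.
    by apply: rpred_sum => l _; apply: rpredZ; rewrite dhomogX; apply/eqP/mdeg1.
  rewrite add1n degh in muh.
  have := deg_homog muh; rewrite to_H_mu -to_H0 deg_homog ?rpred0 //.
  rewrite linear0 mulr_suml linear_sum => rel; rewrite [RHS]rel.
  by apply: eq_bigr => l _; rewrite -scalerAl linearZ /= -mpolyXD extendX.
move=> F Ff; have cF := pureD Ff.
exists (fun c => enum_val (cast_ord (esym cF) c)), (eps F); split.
- by move=> c1 c2 /enum_val_inj/cast_ord_inj.
- apply/setP=> i; apply/idP/imsetP => [iF|[c _ ->]]; last exact: enum_valP.
  by exists (cast_ord cF (enum_rank_in iF i)); rewrite // cast_ordK enum_rankK_in.
rewrite /volume -xfaceE deg_facet //; congr (_ / \det _).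
apply/matrixP=> i c; rewrite !mxE.
have lt_c : (c < size (enum F))%N by rewrite -cardE cF.
have j0 : 'I_n by case: (enum F) lt_c => [//|j].
rewrite (nth_map j0) //; congr coef_a; rewrite (enum_val_nth j0) //.
Qed.

(** ** Nonvanishing in the Gorenstein quotient *)

Let top (q : P) : K := extend volume (pihomog mdeg d q).

Let topD q1 q2 : top (q1 + q2) = top q1 + top q2.
Proof. by rewrite /top !raddfD. Qed.

Let top0 : top 0 = 0.
Proof. by rewrite /top !raddf0. Qed.

Let topZ c q : top (c *: q) = c * top q.
Proof.
rewrite /top (_ : pihomog _ _ (c *: q) = c *: pihomog mdeg d q); last exact: linearZ.
by rewrite linearZ.
Qed.

Let top_monomials q z : (forall h, top ('X_[h] * q) = 0) -> top (z * q) = 0.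
Proof.
move=> q0; rewrite [z]mpolyE mulr_suml (big_morph top topD top0) big1 // => h _.
by rewrite -scalerAl topZ q0 mulr0.
Qed.

Let top_homog q e : q \is ishomog1 e mdeg ->
  (e = d -> extend volume q = 0) -> top q = 0.
Proof.
move=> qh q0; have [ed|ed] := eqVneq e d.
  by rewrite ed in qh; rewrite /top pihomog_dE ?q0.
by rewrite /top (pihomog_ne0 ed qh) linear0.
Qed.

(* Used for the three ideals below, whose generators lift to polynomials all of
   whose multiples are killed by [top]. *)
Let sum_lift (S : comPzRingType) (f : P -> S) (s : seq (S * S)) :
  f 0 = 0 -> (forall q1 q2, f (q1 + q2) = f q1 + f q2) ->
  (forall c, c \in s -> exists2 q, top q = 0 & c.1 * c.2 = f q) ->
  exists2 q, top q = 0 & \sum_(c <- s) c.1 * c.2 = f q.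
Proof.
move=> f0 fD; elim: s => [|c s IH] sP.
  by exists 0; rewrite ?big_nil.
have [q1 t1 e1] := sP c (mem_head _ _).
have [|q2 t2 e2] := IH; first by move=> c' c's; apply: sP; rewrite inE c's orbT.
by exists (q1 + q2); rewrite ?topD ?t1 ?t2 ?addr0 // big_cons e1 e2 fD.
Qed.

(* The ideal that defines the artinian reduction is homogeneous, and the degree
   map is defined on the quotient. *)
Let top_ker q : to_H q = 0 -> top q = 0.
Proof.
move=> /quot_pi_eq0[s [sP def_q]].
have [c cs|q1 t1 e1] :=
    sum_lift (f := quot_pi nonfaces) (s := s) (rmorph0 _) (rmorphD _).
  have [r _ <-] := sP c cs; have [z ->] := quot_pi_surj c.1.
  exists (z * mu k n r); last by rewrite rmorphM.
  apply: top_monomials => h; apply: (top_homog (e := (mdeg h + 1)%N)).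
    apply: dhomogM; first by rewrite dhomogX.
    by apply: rpred_sum => l _; apply: rpredZ; rewrite dhomogX; apply/eqP/mdeg1.
  move=> degh; have := vol_rel volume_volP r (h := h); rewrite -addn1 => /(_ degh) rel.
  rewrite -[RHS]rel mulrC mulr_suml linear_sum; apply: eq_bigr => l _.
  by rewrite -scalerAl linearZ /= -mpolyXD extendX.
have /quot_pi_eq[s2 [s2P defq]] : quot_pi nonfaces q = quot_pi nonfaces q1.
  by rewrite def_q -e1.
have [c cs|q2 t2 e2] := sum_lift (f := id) (s := s2) (erefl _) (fun _ _ => erefl _).
  exists (c.1 * c.2) => //; have [F nonf ->] := s2P c cs.
  apply: top_monomials => h; rewrite xfaceE -mpolyXD.
  apply: (top_homog (e := mdeg (h + mesym1 F)%MM)); first by rewrite dhomogX.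
  move=> degh; rewrite extendX (vol_nonface volume_volP) //.
  apply: contra nonf => /(proj2 complexD); apply.
  by rewrite msupportD msupport_mesym1 finset.subsetUr.
by rewrite -[q](subrK q1) topD defq e2 t2 t1 addr0.
Qed.

(** The kernel of the pairing is generated by homogeneous elements, and its part
    of degree [d] is killed by the degree map. *)
Lemma gorenstein_top_neq0 q : q \is ishomog1 d mdeg -> extend volume q != 0 ->
  quot_pi (pairing_kernel deg) (to_H q) <> 0.
Proof.
move=> qh nz /quot_pi_eq0[s [sP def_q]]; case/eqP: nz.
have [c cs|q1 t1 e1] := sum_lift (f := to_H) (s := s) to_H0 to_HD.
  have [e [y yh <-] ker] := sP c cs; have [z ->] := to_H_surj c.1.
  exists (z * y); last by rewrite to_HM.
  apply: top_monomials => h; have hy : 'X_[h] * y \is ishomog1 (mdeg h + e) mdeg.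
    by apply: dhomogM => //; rewrite dhomogX.
  apply: (top_homog hy) => degh; rewrite degh in hy.
  rewrite -deg_homog // mulrC to_HM.
  apply: ker; first by rewrite -degh leq_addl.
  have -> : (d - e)%N = mdeg h by rewrite -degh addnK.
  by exists 'X_[h]; rewrite //= dhomogX.
have : top (q - q1) = 0 by apply: top_ker; rewrite to_HB def_q e1 subrr.
move=> t0; have : top q = 0 by rewrite -[q](subrK q1) topD t0 t1 addr0.
by rewrite /top pihomog_dE.
Qed.

Lemma gorenstein_neq0_pairing q m : (m <= d)%N -> q \is ishomog1 m mdeg ->
  quot_pi (pairing_kernel deg) (to_H q) <> 0 ->
  exists2 T, (m + mdeg T)%N = d & extend volume ('X_[T] * q) != 0.
Proof.
move=> le_md qh nz.
have [[y yh ynz]|noy] := pselect (exists2 y, y \is ishomog1 (d - m) mdeg &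
    extend volume (y * q) != 0).
  have [T degT nzT] := extend_mul_neq0 yh ynz.
  by exists T; rewrite // degT subnKC.
case: nz; apply: quot_pi_gen0; exists m; first by exists q.
move=> _ _ [y yh <-]; rewrite -to_HM mulrC deg_homog.
  by apply/eqP; apply: contra_notT noy => nzy; exists y.
by have := dhomogM yh qh; rewrite subnK.
Qed.
End ArtinianReduction.

Theorem theorem1p4 (R : realType) (p : nat) (k : fieldType) (d n : nat)
    (Delta : {set {set 'I_n}}) (eps : {set 'I_n} -> bool)
    (deg : artinian_reduction k d Delta -> ratfun k d n)
    (char_k : p \in [pchar k])
    (Delta_pseudo : pseudomanifold R d Delta)
    (Delta_connected : connected (realization R Delta))
    (Delta_vertices : forall i : 'I_n, [set i]%SET \in Delta)
    (Delta_oriented : orientation k Delta eps)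
    (deg_map : degree_map eps deg)
    (m : nat) (m_le : (p * m <= d)%N)
    (g : gorenstein_quotient deg) (g_deg : gorenstein_part deg m g)
    (g_neq0 : g <> 0) :
  ell deg ^+ (d - p * m) * g ^+ p <> 0.
Proof.
move: g_deg g_neq0 => [_ [q qh <-] <-] {g} q_neq0.
have [complexD pureD _ _] := Delta_pseudo.
have p_gt0 : (0 < p)%N by rewrite prime_gt0 ?(pcharf_prime char_k).
have charK : p \in [pchar (ratfun k d n)].
  by apply: (rmorph_pchar (@FracField.tofrac (mpoly (d * n) k))); rewrite pchar_lalg.
have le_md : (m <= d)%N by apply: leq_trans m_le; rewrite leq_pmull.
have [T degT nzT] := gorenstein_neq0_pairing deg_map le_md qh q_neq0.
have := variable_sum_frobenius_neq0 complexD pureD (partial_dual k d n)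
  (volume_volP pureD deg_map) charK qh m_le degT nzT.
have -> : ell deg ^+ (d - p * m) * quot_pi (pairing_kernel deg) (to_H Delta q) ^+ p =
    quot_pi (pairing_kernel deg)
      (to_H Delta (variable_sum (ratfun k d n) n ^+ (d - p * m) * q ^+ p)).
  by rewrite to_HM !to_HX rmorphM !rmorphXn.
apply: (gorenstein_top_neq0 complexD pureD deg_map).
have := dhomogM (variable_sum_homog (ratfun k d n) n (d - p * m)) (dhomogMn p qh).
by rewrite [(m * p)%N]mulnC subnK.
Qed.
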